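(* Let $a>b\ge0$ be constants. Suppose a graph from $\mathrm{GBM}\big(\tfrac{a\log n}{n},\tfrac{b\log n}{n}\big)$ is provided together with the values $X_u$ of all vertices $u$. Any algorithm to recover the partition will give incorrect output with probability $1-o(1)$ if $a-b<0.5$ or $a<1$. On the other hand, if $a-b>0.5$ and $a>1$, it is possible to recover the partition exactly with probability $1-o(1)$.
   Context: Geometric block model $\mathrm{GBM}(r_s,r_d)$ with $r_s>r_d$: the vertex set is $V=V_1\sqcup V_2$ with $|V_1|=|V_2|=n/2$ (the partition is hidden). Each $u\in V$ receives an independent uniform random number $X_u\in[0,1]$. Vertices $u,v$ are adjacent if and only if $d_L(X_u,X_v)\le r_s$ when $u,v$ lie in the same part, and $d_L(X_u,X_v)\le r_d$ when they lie in different parts, where $d_L(x,y)=\min\{|x-y|,1-|x-y|\}$. Recovering the partition means outputting $\{V_1,V_2\}$ exactly (up to swapping labels). $\log$ is natural. *)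

(* Defs.v *)
From HB Require Import structures.
From mathcomp Require Import all_boot all_order all_algebra.
From mathcomp Require Import all_classical all_reals all_analysis.

Set Implicit Arguments.
Unset Strict Implicit.
Unset Printing Implicit Defensive.

Import Order.TTheory GRing.Theory Num.Theory.
Import numFieldNormedType.Exports.

Local Open Scope classical_set_scope.
Local Open Scope ring_scope.

Definition circle_dist (R : realType) (x y : R) : R :=
  Num.min `|x - y| (1 - `|x - y|).

(* A graph on 'I_n is represented by its set of (ordered) adjacent pairs. *)
Definition graph (n : nat) : Type := {set 'I_n * 'I_n}.

(* The graph determined by the locations x when one part of the bipartition
   is A and the other is its complement. *)
Definition gbm_graph (R : realType) (n : nat) (rs rd : R)
    (A : {set 'I_n}) (x : n.-tuple R) : graph n :=
  [set p : 'I_n * 'I_n | (p.1 != p.2) &&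
    (circle_dist (tnth x p.1) (tnth x p.2)
       <= if (p.1 \in A) == (p.2 \in A) then rs else rd)]%SET.

Definition partition_of (n : nat) (A : {set 'I_n}) : {set {set 'I_n}} :=
  [set A; ~: A]%SET.

Definition balanced (n : nat) (A : {set 'I_n}) : bool := (#|A|.*2 == n)%N.

(* The randomness of the model on n vertices: hidden_part is V_1 (so that V_2
   is its complement) and loc u is X_u.  The hidden bipartition may have any
   law on balanced bipartitions, in particular it may be deterministic.
   In the independence axiom, taking B u = setT or summing over A gives the
   product rule for the subfamilies. *)
Record gbm_model (R : realType) (n : nat) := GbmModel {
  gbm_display : measure_display ;
  gbm_space : measurableType gbm_display ;
  gbm_prob : probability gbm_space R ;
  hidden_part : gbm_space -> {set 'I_n} ;
  loc : 'I_n -> {RV gbm_prob >-> R} ;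
  hidden_part_balanced : forall w, balanced (hidden_part w) ;
  hidden_part_measurable : forall A : {set 'I_n},
    measurable [set w | hidden_part w = A] ;
  loc_uniform : forall (u : 'I_n) (B : set R), measurable B ->
    gbm_prob (loc u @^-1` B) = uniform_prob (@ltr01 R) B ;
  part_loc_independent : forall (A : {set 'I_n}) (B : 'I_n -> set R),
    (forall u, measurable (B u)) ->
    gbm_prob ([set w | hidden_part w = A]
                `&` [set w | forall u, B u (loc u w)])
    = (gbm_prob [set w | hidden_part w = A]
         * \prod_(u < n) gbm_prob (loc u @^-1` B u))%E
}.

Definition uniform_part (R : realType) (n : nat) (M : gbm_model R n) : Prop :=
  forall A : {set 'I_n}, balanced A ->
    gbm_prob M [set w | hidden_part w = A] = (('C(n, n./2)%:R)^-1)%:E.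

Definition locations (R : realType) (n : nat) (M : gbm_model R n)
    (w : gbm_space M) : n.-tuple R :=
  [tuple loc M u w | u < n].

(* A possibly randomized algorithm: its output is a measurable function of the
   locations, the graph and a random seed drawn from a space of its own. *)
Record algorithm (R : realType) (n : nat) := Algorithm {
  seed_display : measure_display ;
  seed_space : measurableType seed_display ;
  seed_prob : probability seed_space R ;
  run : n.-tuple R -> graph n -> seed_space -> {set {set 'I_n}} ;
  run_measurable : forall (g : graph n) (c : {set {set 'I_n}}),
    measurable [set xs : n.-tuple R * seed_space | run xs.1 g xs.2 = c]
}.

Definition output (R : realType) (n : nat) (rs rd : R) (M : gbm_model R n)
    (alg : algorithm R n) (w : gbm_space M) (s : seed_space alg) :
    {set {set 'I_n}} :=
  run (locations w) (gbm_graph rs rd (hidden_part w) (locations w)) s.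

(* The product measure makes the seed independent of the model. *)
Definition success_prob (R : realType) (n : nat) (rs rd : R)
    (M : gbm_model R n) (alg : algorithm R n) : \bar R :=
  (gbm_prob M \x seed_prob alg)%E
    [set ws | output rs rd ws.1 ws.2 = partition_of (hidden_part ws.1)].

Definition failure_prob (R : realType) (n : nat) (rs rd : R)
    (M : gbm_model R n) (alg : algorithm R n) : \bar R :=
  (gbm_prob M \x seed_prob alg)%E
    [set ws | output rs rd ws.1 ws.2 <> partition_of (hidden_part ws.1)].

Definition log_radius (R : realType) (c : R) (n : nat) : R :=
  c * ln n%:R / n%:R.

(* Main.v *)
Require Import Defs.
From HB Require Import structures.
From mathcomp Require Import all_boot all_order all_algebra.
From mathcomp Require Import all_classical all_reals all_analysis.
From mathcomp Require Import measurable_realfun.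
From mathcomp Require Import zify ring lra.

Set Implicit Arguments.
Unset Strict Implicit.
Unset Printing Implicit Defensive.

Import Order.TTheory GRing.Theory Num.Theory.
Import numFieldNormedType.Exports.

(* Cut the circle into N cells of length about log n / (D n), with D a large
   constant; a fixed set of j cells contains no vertex with probability
   (1 - j/N)^n, about n^(-j/D).  A pair of vertices is informative when its
   distance lies in (r_d, r_s].

   Impossibility.  Let F_1, ..., F_k be disjoint nonempty sets of vertices such
   that no informative pair leaves any F_i.  Exchanging the parts inside a union
   of F_i's does not change the graph, so at most 2^(n-k) graphs arise from the
   2^n subsets, whereas the balanced partition is uniform among C(n, n/2) sets:
   any algorithm succeeds with probability at most 2 (n+1) / 2^k.  If a < 1, the
   F_i are the vertices between consecutive empty arcs longer than r_s; if
   a - b < 1/2 and b > 0, they are the vertices of a cell both of whose annuli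
   are empty.  A second moment estimate over disjoint blocks of cells shows that
   k is at least of order log n with high probability.

   Recovery.  If the informative pairs form a connected graph, the partition can
   be read off.  With high probability, among any M consecutive cells (M
   constant) fewer than D are empty.  Then there are fully occupied stretches on
   both sides of every cell.  As a > 1, walks with steps of q >= D cells, one for
   each residue mod q, cannot all be blocked by fewer than D empty cells, so
   these stretches are connected together; as a - b > 1/2, the walks leaving a
   given vertex to the left and to the right cannot all be blocked either, so
   the vertex is connected to one of the stretches. *)

(** * Connectivity along a cyclic sequence of cells *)

Section CyclicConnectivity.
Variables (T : finType) (e : rel T) (N : nat) (cell : T -> nat).
Variables (p q D : nat).
Hypothesis e_sym : symmetric e.
Hypothesis cell_lt : forall u, cell u < N.
Hypothesis p_gt0 : 0 < p.
Hypothesis lt_pq : p < q.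
Hypothesis le_Dq : D <= q.
Hypothesis D_le_steps : D <= (q - p).+1.*2.
Hypothesis adjacent : forall u v t, p <= t <= q ->
  cell v = (cell u + t) %% N -> e u v.

(** Positions are unbounded naturals read modulo [N], so that walks along the circle need no case
    for passing the origin. *)
Definition lies_at (z : nat) (u : T) : bool := cell u == z %% N.
Definition occupied (z : nat) : bool := [exists u, lies_at z u].
(** A zone is made of [D] blocks of 2q cells, so fewer than [D] empty cells leave one block full. A
    window is a zone on each side of q + 1 central cells. *)
Definition zone : nat := D * q.*2.
Definition window : nat := zone.*2 + q.+1.

Hypothesis few_empty : forall z,
  #|[set t : 'I_window | ~~ occupied (z + t)]| < D.

Let q_gt0 : 0 < q. Proof. exact: leq_ltn_trans lt_pq. Qed.
Let csym : connect_sym e. Proof. exact: sym_connect_sym. Qed.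

Let zone_ge : q.*2 <= zone.
Proof. by apply: leq_pmull; exact: leq_ltn_trans (few_empty 0). Qed.

Lemma lies_at_step z t u v :
  p <= t <= q -> lies_at z u -> lies_at (z + t) v -> connect e u v.
Proof.
move=> tpq /eqP zu /eqP zv; apply/connect1/(adjacent tpq).
by rewrite zu zv modnDml.
Qed.

Lemma occupiedP z : occupied z -> exists u, lies_at z u.
Proof. by move/existsP. Qed.

Lemma walk_up k y u : lies_at y u ->
  (forall j, j <= k -> occupied (y + j * q)) ->
  exists2 w, lies_at (y + k * q) w & connect e u w.
Proof.
move=> yu; elim: k => [|k IH] occ; first by exists u; rewrite ?mul0n ?addn0.
have [j jk|w yw uw] := IH; first by apply: occ; lia.
have [w' yw'] := occupiedP (occ k.+1 (leqnn _)).
exists w' => //; apply: connect_trans uw _.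
apply: (@lies_at_step _ q _ _ _ yw); first by rewrite leqnn ltnW.
by have -> : y + k * q + q = y + k.+1 * q by lia.
Qed.

Lemma walk_down k y u : lies_at (y + k * q) u ->
  (forall j, j <= k -> occupied (y + j * q)) ->
  exists2 w, lies_at y w & connect e u w.
Proof.
elim: k u => [|k IH] u yu occ; first by exists u => //; rewrite mul0n addn0 in yu.
have [w yw] := occupiedP (occ k (leqnSn _)).
have [j jk|w' yw' ww'] := IH w yw; first by apply: occ; lia.
exists w' => //; apply: connect_trans ww'; rewrite csym.
apply: (@lies_at_step _ q _ _ _ yw); first by rewrite leqnn ltnW.
by rewrite -addnA [_ * _ + _]addnC -mulSn.
Qed.

(** The length 2q guarantees that each cell of the stretch has another cell of the stretch at
    distance exactly q. *)
Definition full (c : nat) : Prop := forall i, i < q.*2 -> occupied (c + i).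

(** Vertices of one cell need not be adjacent, but they share a neighbour q cells up or down the
    stretch. *)
Lemma full_same_cell c i u v : full c -> i < q.*2 ->
  lies_at (c + i) u -> lies_at (c + i) v -> connect e u v.
Proof.
move=> fc iq cu cv; case: (ltnP i q) => iq'.
  have [|w cw] := occupiedP (fc (i + q) _); first by lia.
  rewrite addnA in cw.
  apply: (@connect_trans _ _ w); last rewrite csym.
    by apply: lies_at_step cu cw; rewrite leqnn ltnW.
  by apply: lies_at_step cv cw; rewrite leqnn ltnW.
have [|w cw] := occupiedP (fc (i - q) _); first by lia.
have ci : c + i = c + (i - q) + q by lia.
rewrite ci in cu cv.
apply: (@connect_trans _ _ w); first rewrite csym.
  by apply: lies_at_step cw cu; rewrite leqnn ltnW.
by apply: lies_at_step cw cv; rewrite leqnn ltnW.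
Qed.

(** A common neighbour lies q cells from one of them and q - 1 >= p cells from the other; this is
    where p < q enters. *)
Lemma full_next_cell c i u v : full c -> i.+1 < q.*2 ->
  lies_at (c + i) u -> lies_at (c + i.+1) v -> connect e u v.
Proof.
move=> fc iq cu cv; case: (ltnP i q) => iq'.
  have [|w cw] := occupiedP (fc (i + q) _); first by lia.
  have cw' : lies_at (c + i.+1 + q.-1) w.
    by have -> : c + i.+1 + q.-1 = c + (i + q) by lia.
  rewrite addnA in cw.
  apply: (@connect_trans _ _ w); last rewrite csym.
    by apply: lies_at_step cu cw; lia.
  by apply: lies_at_step cv cw'; lia.
have [|w cw] := occupiedP (fc (i.+1 - q) _); first by lia.
have ci : c + i = c + (i.+1 - q) + q.-1 by lia.
have ci1 : c + i.+1 = c + (i.+1 - q) + q by lia.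
rewrite ci in cu; rewrite ci1 in cv.
apply: (@connect_trans _ _ w); first rewrite csym.
  by apply: lies_at_step cw cu; lia.
by apply: lies_at_step cw cv; lia.
Qed.

Lemma full_connected c i j u v : full c -> i < q.*2 -> j < q.*2 ->
  lies_at (c + i) u -> lies_at (c + j) v -> connect e u v.
Proof.
move=> fc; wlog ij : i j u v / i <= j => [th iq jq cu cv|].
  by case/orP: (leq_total i j) => ij; last rewrite csym; apply: th ij _ _ _ _.
rewrite -(subnKC ij); move: (j - i) => k {j ij}.
elim: k v => [|k IH] v iq jq cu cv.
  by rewrite addn0 in cv; apply: full_same_cell cu cv.
have [|w cw] := occupiedP (fc (i + k) _); first by lia.
apply: (@connect_trans _ _ w); first by apply: IH => //; lia.
by rewrite (addnS i) in jq cv; apply: full_next_cell fc jq cw cv.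
Qed.

(** Pigeonhole form of [few_empty]: every later blocking argument produces an injective family of
    empty cells in one window. *)
Lemma few_empty_inj (I : finType) (z : nat) (f : I -> nat) : injective f ->
  (forall i, f i < window) -> (forall i, ~~ occupied (z + f i)) -> #|I| < D.
Proof.
move=> finj fM fe; apply: leq_ltn_trans (few_empty z).
have ginj : injective (fun i => Ordinal (fM i)).
  by move=> i j /(congr1 val)/finj.
rewrite -(card_imset predT ginj); apply/subset_leq_card/fintype.subsetP => t.
by case/imsetP => i _ ->; rewrite inE fe.
Qed.

Lemma exists_full z s : s + zone <= window ->
  exists2 c, s <= c /\ c + q.*2 <= s + zone & full (z + c).
Proof.
move=> sM.
have [/existsP[j /forallP fj]|/existsPn nf] := boolP [exists j : 'I_D,
    [forall i : 'I_q.*2, occupied (z + (s + j * q.*2) + i)]].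
  exists (s + j * q.*2); last by move=> i iq; apply: (fj (Ordinal iq)).
  split; first by rewrite leq_addr.
  by rewrite -addnA leq_add2l addnC -mulSn leq_mul2r ltn_ord orbT.
have {}nf (j : 'I_D) : {i : 'I_q.*2 | ~~ occupied (z + (s + j * q.*2) + i)}.
  by have := nf j; rewrite negb_forall => /existsP/sigW.
pose f (j : 'I_D) := s + j * q.*2 + sval (nf j).
have : #|'I_D| < D; last by rewrite card_ord ltnn.
apply: (@few_empty_inj _ z f) => [j j'|j|j].
- rewrite /f -!addnA => /addnI /(congr1 (fun m => m %/ q.*2)).
  rewrite !divnMDl ?double_gt0// !divn_small// !addn0.
  exact: val_inj.
- apply: leq_trans sM; rewrite /f -addnA -addnS leq_add2l.
  apply: (@leq_trans (j.+1 * q.*2)); last by rewrite leq_mul2r ltn_ord orbT.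
  by rewrite mulSn addnC ltn_add2r.
- by rewrite /f addnA; case: (nf j).
Qed.

(** The q residue classes are disjoint, and q >= [D] exceeds the number of empty cells, so they
    cannot all be hit. *)
Lemma occupied_residue z : exists2 r, r < q &
  forall t, t < window -> t %% q = r -> occupied (z + t).
Proof.
have [/existsP[r /forallP fr]|/existsPn nf] := boolP [exists r : 'I_q,
    [forall t : 'I_window, (t %% q == r) ==> occupied (z + t)]].
  exists r => // t tM tr; have := fr (Ordinal tM).
  by rewrite /= tr eqxx.
have {}nf (r : 'I_q) : {t : 'I_window | (t %% q == r) && ~~ occupied (z + t)}.
  have := nf r; rewrite negb_forall => /existsP/sigW[t].
  by rewrite negb_imply => ?; exists t.
have : #|'I_q| < D; last by rewrite card_ord ltnNge le_Dq.
apply: (@few_empty_inj _ z (fun r => val (sval (nf r)))) => [r r'|r|r].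
- case: (nf r) (nf r') => [t /andP[/eqP tr _]] [t' /andP[/eqP tr' _]] /= tt'.
  by apply: val_inj; rewrite /= -tr -tr' tt'.
- exact: ltn_ord.
- by case: (nf r) => t /= /andP[].
Qed.

(** Steps of q cannot jump over a full stretch of 2q cells. *)
Lemma reach_up x c : x < c + q ->
  exists k, c <= x + k * q < c + q.*2.
Proof.
move=> xc; have [cx|xltc] := leqP c x; first by exists 0; lia.
exists ((c - x) %/ q).+1.
have := divn_eq (c - x) q; have := ltn_pmod (c - x) q_gt0.
by move: ((c - x) %/ q) ((c - x) %% q) => a b; lia.
Qed.

Lemma reach_down x c : c <= x ->
  exists2 k, k * q <= x & c <= x - k * q < c + q.
Proof.
move=> cx; exists ((x - c) %/ q);
have := divn_eq (x - c) q; have := ltn_pmod (x - c) q_gt0;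
by move: ((x - c) %/ q) ((x - c) %% q) => a b; lia.
Qed.

(** Walk by steps of q along an unobstructed residue class, from the left stretch until the right
    one is entered. *)
Lemma cores_connected z cL cR u v : full (z + cL) -> full (z + cR) ->
  cL <= cR -> cR + q.*2 <= window ->
  lies_at (z + cL) u -> lies_at (z + cR) v -> connect e u v.
Proof.
move=> fL fR LR RM zu zv.
have [r rq fr] := occupied_residue z.
(* Offset from [cL] to the first position of residue [r]; being below q, it stays in the left
   stretch. *)
pose t := (if cL %% q <= r then r - cL %% q else r + q - cL %% q).
have cq := ltn_pmod cL q_gt0.
have tq : t < q by rewrite /t; case: ifP; lia.
have tr : (cL + t) %% q = r.
  have eL := divn_eq cL q.
  rewrite {1}eL /t; case: ifP => h.
    by rewrite -addnA subnKC// modnMDl modn_small.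
  rewrite -addnA subnKC; last by lia.
  by rewrite modnMDl modnDr modn_small.
have [|k /andP[k1 k2]] := @reach_up (cL + t) cR; first by lia.
have [|w zw] := occupiedP (fL t _); first by lia.
rewrite -addnA in zw.
have [j jk|w' zw' ww'] := walk_up (k := k) zw.
  rewrite -addnA; apply: fr; last by rewrite addnC modnMDl.
  have : j * q <= k * q by rewrite leq_mul2r jk orbT.
  lia.
apply: (@connect_trans _ _ w).
  apply: (@full_connected _ 0 t _ _ fL) => //; try lia; first by rewrite addn0.
  by rewrite -addnA.
apply: connect_trans ww' _.
apply: (@full_connected _ (cL + t + k * q - cR) 0 _ _ fR) => //; try lia.
  by have -> : z + cR + (cL + t + k * q - cR) = z + (cL + t) + k * q by lia.
by rewrite addn0.
Qed.

(* The walks leaving a vertex have first step in [p, q] and later steps q, on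
   either side; distinct first steps give distinct residues mod q, so blocking
   all of them takes 2 (q - p + 1) >= D empty cells. *)
Lemma free_walk z i : zone <= i <= zone + q ->
  exists2 t, p <= t <= q &
    (forall k, i + t + k * q < window -> occupied (z + (i + t + k * q))) \/
    (forall k, t + k * q <= i -> occupied (z + (i - (t + k * q)))).
Proof.
move=> iZ.
(* The number of steps is bounded by [window] to make the two statements decidable; [kM] shows that
   the bound loses nothing for downward walks. *)
pose up (t : 'I_(q - p).+1) := [forall k : 'I_window,
  (i + (p + t) + k * q < window) ==> occupied (z + (i + (p + t) + k * q))].
pose dn (t : 'I_(q - p).+1) := [forall k : 'I_window,
  (p + t + k * q <= i) ==> occupied (z + (i - (p + t + k * q)))].
have kM k : k * q <= i + q -> k < window.
  move=> kq; have : k <= k * q by rewrite leq_pmulr.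
  by have := zone_ge; rewrite /window; lia.
have [/existsP[t /orP[/forallP ut|/forallP dt]]|/existsPn nf] :=
    boolP [exists t, up t || dn t].
- exists (p + t); first by have := ltn_ord t; lia.
  left=> k kw; have kM' : k < window.
    have : k <= k * q by rewrite leq_pmulr.
    lia.
  by have := ut (Ordinal kM'); rewrite /= kw.
- exists (p + t); first by have := ltn_ord t; lia.
  right=> k kw; have kM' : k < window by apply: kM; lia.
  by have := dt (Ordinal kM'); rewrite /= kw.
have nu (t : 'I_(q - p).+1) : {k | (i + (p + t) + k * q < window) &&
    ~~ occupied (z + (i + (p + t) + k * q))}.
  have := nf t; rewrite negb_or => /andP[+ _].
  rewrite negb_forall => /existsP/sigW[k].
  by rewrite negb_imply => ?; exists (val k).
have nd (t : 'I_(q - p).+1) : {k | (p + t + k * q <= i) &&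
    ~~ occupied (z + (i - (p + t + k * q)))}.
  have := nf t; rewrite negb_or => /andP[_ +].
  rewrite negb_forall => /existsP/sigW[k].
  by rewrite negb_imply => ?; exists (val k).
pose f (x : bool * 'I_(q - p).+1) :=
  if x.1 then i + (p + x.2) + sval (nu x.2) * q
  else i - (p + x.2 + sval (nd x.2) * q).
have residue (t t' : 'I_(q - p).+1) : t = t' %[mod q] -> t = t'.
  have sq (s : 'I_(q - p).+1) : s < q by have := ltn_ord s; lia.
  by rewrite !modn_small// => tt'; apply: val_inj.
have : #|{: bool * 'I_(q - p).+1}| < D; last first.
  by rewrite card_prod card_bool card_ord mul2n ltnNge D_le_steps.
(* Cells on opposite sides of [i] differ because p > 0; on one side, equal cells give first steps
   that agree modulo q and range over fewer than q values. *)
apply: (@few_empty_inj _ z f) => [[[] t] [[] t']|[[] t]|[[] t]]; rewrite /f /=.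
- case: (nu t) (nu t') => [k _] [k' _] /=; rewrite -!addnA.
  move=> /addnI/addnI ekk'; congr (_, _); apply: residue.
  by have := congr1 (modn^~ q) ekk'; rewrite ![_ + _ * q]addnC !modnMDl.
- by case: (nu t) (nd t') => [k _] [k' /andP[? _]] /=; lia.
- by case: (nu t') (nd t) => [k _] [k' /andP[? _]] /=; lia.
- case: (nd t) (nd t') => [k /andP[ki _]] [k' /andP[ki' _]] /= ekk'.
  congr (_, _); apply: residue.
  have : t + k * q = t' + k' * q by lia.
  by move/(congr1 (modn^~ q)); rewrite ![_ + _ * q]addnC !modnMDl.
- by case: (nu t) => k /= /andP[].
- by case: (nd t) => k /= /andP[ki _]; rewrite /window; lia.
- by case: (nu t) => k /= /andP[].
- by case: (nd t) => k /= /andP[].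
Qed.

(** Each central vertex has a free walk into one of the two full stretches, which are themselves
    connected. Writing [z] as [z' + zone] provides the zone on the left. *)
Lemma window_connected z i j u v : i <= q -> j <= q ->
  lies_at (z + i) u -> lies_at (z + j) v ->
  (exists z', z = z' + zone) -> connect e u v.
Proof.
move=> iq jq zu zv [z' ez].
have [|cL [_ cL2] fL] := @exists_full z' 0; first by rewrite /window; lia.
have [|cR [cR1 cR2] fR] := @exists_full z' (zone + q.+1).
  by rewrite /window; lia.
rewrite add0n in cL2.
have [|wL zwL] := occupiedP (fL 0 _); first by lia.
have [|wR zwR] := occupiedP (fR 0 _); first by lia.
rewrite !addn0 in zwL zwR.
have LR : connect e wL wR.
  by apply: (cores_connected fL fR) => //; rewrite /window; lia.
suff to_core h w : h <= q -> lies_at (z + h) w -> connect e w wR.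
  apply: (@connect_trans _ _ wR); first exact: to_core zu.
  by rewrite csym; apply: to_core zv.
move=> hq zw; rewrite ez -addnA in zw.
have [|t tpq [up|dn]] := @free_walk z' (zone + h); first by lia.
- have [|k /andP[k1 k2]] := @reach_up (zone + h + t) cR; first by lia.
  have upj j' : j' <= k -> occupied (z' + (zone + h + t) + j' * q).
    move=> jk; rewrite -addnA; apply: up.
    have : j' * q <= k * q by rewrite leq_mul2r jk orbT.
    rewrite /window; lia.
  have := upj 0 isT; rewrite mul0n addn0 => /occupiedP[w1 zw1].
  have [w2 zw2 w12] := walk_up zw1 upj.
  apply: (@connect_trans _ _ w1).
    by apply: (lies_at_step tpq zw); rewrite -addnA.
  apply: connect_trans w12 _.
  apply: (@full_connected _ (zone + h + t + k * q - cR) 0 _ _ fR); try lia.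
    by have -> : z' + cR + (zone + h + t + k * q - cR) =
      z' + (zone + h + t) + k * q by lia.
  by rewrite addn0.
- have [|k k0 /andP[k1 k2]] := @reach_down (zone + h - t) cL; first by lia.
  set y := zone + h - t - k * q in k1 k2 *.
  have dnj j' : j' <= k -> occupied (z' + y + j' * q).
    move=> jk; have jk' : j' * q <= k * q by rewrite leq_mul2r jk orbT.
    have e1 : (k - j') * q + j' * q = k * q by rewrite -mulnDl subnK.
    have := dn (k - j').
    have -> : zone + h - (t + (k - j') * q) = y + j' * q by lia.
    by rewrite addnA; apply; lia.
  have := dnj k (leqnn _) => /occupiedP[w1 zw1].
  have [w2 zw2 w12] := walk_down zw1 dnj.
  apply: (@connect_trans _ _ w1).
    rewrite csym; apply: (lies_at_step tpq zw1).
    by have -> : z' + y + k * q + t = z' + (zone + h) by lia.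
  apply: connect_trans w12 _; apply: connect_trans LR.
  apply: (@full_connected _ (y - cL) 0 _ _ fL); try lia.
    by have -> : z' + cL + (y - cL) = z' + y by lia.
  by rewrite addn0.
Qed.

Lemma all_connected u v : connect e u v.
Proof.
have N_gt0 : 0 < N by apply: leq_ltn_trans (cell_lt u).
(* Adding [zone] turns leaves room for a left zone at every position from here on. *)
pose z0 := cell u + zone * N.
have zu : lies_at z0 u by rewrite /lies_at /z0 addnC modnMDl modn_small.
have base k : exists z', z0 + k = z' + zone.
  exists (z0 + k - zone); rewrite subnK//.
  have : zone <= zone * N by rewrite leq_pmulr.
  rewrite /z0; lia.
suff main k w : lies_at (z0 + k) w -> connect e u w.
  apply: (main (N + cell v - cell u)); rewrite /lies_at.
  have -> : z0 + (N + cell v - cell u) = zone.+1 * N + cell v.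
    by rewrite /z0 mulSn; have := cell_lt u; lia.
  by rewrite modnMDl modn_small.
(* A displacement up to q fits in the centre of one window. Otherwise one of the q cells before the
   target is occupied: its vertex is reached by induction and shares a window centre with [w]. *)
elim/ltn_ind: k w => k IH w zw; have [kq|qk] := leqP k q.
  by apply: (@window_connected z0 0 k); rewrite ?addn0//;
    have := base 0; rewrite addn0.
have [[i iq] oi] : exists i : 'I_q, occupied (z0 + (k - q) + i).
  apply/existsP; apply: contraT => /existsPn nf.
  have [z' ez] := base (k - q).
  have : #|'I_q| < D; last by rewrite card_ord ltnNge le_Dq.
  apply: (@few_empty_inj _ z' (fun i : 'I_q => zone + i)) => [i j|i|i].
  - by move=> /addnI; apply: val_inj.
  - by rewrite /window; have := ltn_ord i; lia.
  - by rewrite addnA -ez; apply: nf.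
have [x zx] := occupiedP oi.
apply: (@connect_trans _ _ x).
  by apply: (IH (k - q + i)); rewrite ?addnA//; rewrite /=; lia.
apply: (@window_connected (z0 + (k - q)) i q) => //; first by rewrite /= ltnW.
by rewrite -addnA subnK// ltnW.
Qed.

End CyclicConnectivity.

(** * Flips that preserve the graph *)

Section FlipCounting.
Variables (T : finType).

Definition flip (S A : {set T}) : {set T} :=
  [set t | (t \in A) (+) (t \in S)].

Lemma flip_injl (A S S' : {set T}) : flip S A = flip S' A -> S = S'.
Proof.
by move=> /setP e; apply/setP => t; have := e t; rewrite !inE; apply: addbI.
Qed.

(** Fix one preimage of each value of [G]. Flipping it along the unions indexed by all J gives
    [2 ^ #|I|] preimages of that value, all distinct. *)
Lemma card_flip_invariant (U : finType) (G : {set T} -> U)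
    (I : finType) (F : I -> {set T}) :
  (forall i, F i != finset.set0) -> (forall i j, i != j -> [disjoint F i & F j]) ->
  (forall (J : {set I}) A, G (flip (\bigcup_(i in J) F i) A) = G A) ->
  #|[set G A | A : {set T}]| * 2 ^ #|I| <= 2 ^ #|T|.
Proof.
move=> F0 Fdis GF.
pose rep g := odflt finset.set0 [pick A | G A == g].
have repK g : g \in [set G A | A : {set T}] -> G (rep g) = g.
  move=> /imsetP[A _ ->]; rewrite /rep; case: pickP => [B /eqP//|/(_ A)].
  by rewrite eqxx.
pose h (x : U * {set I}) := flip (\bigcup_(i in x.2) F i) (rep x.1).
(* Disjoint nonempty sets: their union determines the indices. *)
have cupI (J J' : {set I}) :
    \bigcup_(i in J) F i = \bigcup_(i in J') F i -> J = J'.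
  have memJ (K : {set I}) i t : t \in F i ->
      (t \in \bigcup_(j in K) F j) = (i \in K).
    move=> ti; apply/finset.bigcupP/idP => [[j jK tj]|iK]; last by exists i.
    have [<-//|/Fdis] := eqVneq j i.
    by move=> /pred0P /(_ t); rewrite /= ti tj.
  move=> e; apply/setP => i; have /set0Pn[t ti] := F0 i.
  by rewrite -(memJ J i t ti) e (memJ J' i t ti).
have cardP (V : finType) : 2 ^ #|V| = #|[set: {set V}]|.
  by rewrite -powersetT card_powerset cardsT.
rewrite !cardP -cardsX -(card_in_imset (f := h)).
  by rewrite subset_leq_card// finset.subsetT.
move=> [g J] [g' J']; rewrite !inE !andbT /= => gI gI' ehh.
have GE x K : x \in [set G A | A : {set T}] -> G (h (x, K)) = x.
  by move=> xI; rewrite /h GF repK.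
have egg : g = g' by rewrite -(GE g J gI) ehh GE.
subst g'; congr (_, _); apply: cupI.
exact: flip_injl ehh.
Qed.

(** All sets decoded correctly from one graph are members of the single decoded pair, so a graph
    accounts for at most two of them. *)
Lemma card_decoded (U : finType) (G : {set T} -> U)
    (dec : U -> {set {set T}}) :
  #|[set A | dec (G A) == [set A; ~: A]]| <= #|[set G A | A : {set T}]|.*2.
Proof.
pose C := [set A | dec (G A) == [set A; ~: A]].
rewrite -muln2 -sum_nat_const -/C -sum1_card.
rewrite (partition_big G (mem [set G A | A : {set T}])) /=; last first.
  by move=> A _; apply: imset_f.
apply: leq_sum => g _; rewrite sum1_card.
have [A /andP[AC /eqP GA]|/eq_card0-> //] :=
  pickP [pred A | (A \in C) && (G A == g)].
apply: (@leq_trans #|[set A; ~: A]|); last by rewrite cards2; case: (_ != _).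
apply/subset_leq_card/fintype.subsetP => B /andP[]; rewrite inE => /eqP decB /eqP GB.
move: AC; rewrite inE => /eqP; rewrite GA -GB decB => <-.
by rewrite !inE eqxx.
Qed.
End FlipCounting.

Local Open Scope classical_set_scope.
Local Open Scope ring_scope.

(** * Inequalities between probabilities from pointwise ones *)

(** This is (c - y)^2 >= (c/2)^2 with the cross term moved to the left. *)
Lemma sqr_deviation_ge (R : realType) (c y : R) : 0 <= c -> y <= c / 2 ->
  c ^+ 2 / 4 + 2 * c * y <= c ^+ 2 + y ^+ 2.
Proof. by move=> c0 yc; nra. Qed.

Section IndicatorInequalities.
Context d (T : measurableType d) (R : realType) (P : probability T R).

Definition pr (A : set T) : R := fine (P A).

Lemma prE A : measurable A -> P A = (pr A)%:E.
Proof. by move=> mA; rewrite fineK// fin_num_measure. Qed.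

Lemma pr_ge0 A : 0 <= pr A. Proof. exact: fine_ge0. Qed.

Lemma pr_le1 A : measurable A -> pr A <= 1.
Proof. by move=> mA; rewrite -lee_fin -prE// probability_le1. Qed.

Lemma prT : pr setT = 1. Proof. by rewrite /pr probability_setT. Qed.

Lemma prC A : measurable A -> pr (~` A) = 1 - pr A.
Proof.
move=> mA; apply: EFin_inj.
by rewrite EFinB -!prE ?probability_setC//; exact: measurableC.
Qed.

Lemma le_pr A B : measurable A -> measurable B -> A `<=` B -> pr A <= pr B.
Proof.
by move=> mA mB AB; rewrite -lee_fin -!prE//; apply: le_measure; rewrite ?inE.
Qed.

Lemma integral_sum_indic (I : finType) (a b : R) (B : set T) (E : I -> set T) :
  0 <= a -> 0 <= b -> measurable B -> (forall i, measurable (E i)) ->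
  (\int[P]_w (a * \1_B w + b * \sum_i \1_(E i) w)%:E)%E =
  (a * pr B + b * \sum_i pr (E i))%:E.
Proof.
move=> a0 b0 mB mE.
have mi (A : set T) : measurable A ->
    measurable_fun setT (EFin \o (\1_A : T -> R)).
  by move=> mA; apply/measurable_EFinP; exact: measurable_indic.
have int1 A : measurable A -> (\int[P]_w (\1_A w)%:E = (pr A)%:E)%E.
  by move=> mA; rewrite integral_indic// setIT -prE.
have sum0 w : (0 <= \sum_i (\1_(E i) w : R)%:E)%E.
  by apply: sume_ge0 => i _; rewrite lee_fin.
under eq_integral do rewrite EFinD !EFinM -sumEFin.
rewrite ge0_integralD//=; last 4 first.
- by move=> w _; rewrite mule_ge0// lee_fin.
- by apply: emeasurable_funM => //; exact: mi.
- by move=> w _; rewrite mule_ge0// lee_fin.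
- apply: emeasurable_funM => //; apply: emeasurable_sum => i; exact: mi.
rewrite ge0_integralZl//; last exact: mi.
rewrite ge0_integralZl//; last by apply: emeasurable_sum => i; exact: mi.
rewrite ge0_integral_sum//; last by move=> i; exact: mi.
rewrite int1// EFinD !EFinM -sumEFin.
congr (_ + _ * _)%E; apply: eq_bigr => i _.
exact: int1.
Qed.

(** Integration of a pointwise inequality; the union bound and the inequalities of Markov and
    Chebyshev are instances. Nonnegative coefficients keep both integrands nonnegative. *)
Lemma sum_indic_le (I J : finType) (a b a' b' : R) (B : set T)
    (E : I -> set T) (F : J -> set T) :
  0 <= a -> 0 <= b -> 0 <= a' -> 0 <= b' -> measurable B ->
  (forall i, measurable (E i)) -> (forall j, measurable (F j)) ->
  (forall w, a * \1_B w + b * \sum_i \1_(E i) w <=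
             a' + b' * \sum_j \1_(F j) w) ->
  a * pr B + b * \sum_i pr (E i) <= a' + b' * \sum_j pr (F j).
Proof.
move=> a0 b0 a'0 b'0 mB mE mF le; rewrite -[X in _ <= X + _]mulr1 -prT.
rewrite -lee_fin -!integral_sum_indic//.
have nneg c e (C : set T) (K : finType) (G : K -> set T) w : 0 <= c -> 0 <= e ->
    0 <= c * \1_C w + e * \sum_k \1_(G k) w.
  move=> c0 e0; apply: addr_ge0; apply: mulr_ge0 => //.
  by apply: sumr_ge0.
have meas c e (C : set T) (K : finType) (G : K -> set T) : measurable C ->
    (forall k, measurable (G k)) ->
    measurable_fun setT
      (EFin \o (fun w => c * \1_C w + e * \sum_k \1_(G k) w) : T -> \bar R).
  move=> mC mG; apply/measurable_EFinP; apply: measurable_funD.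
    by apply: measurable_funM => //; exact: measurable_indic.
  apply: measurable_funM => //; apply: measurable_sum => k.
  exact: measurable_indic.
apply: ge0_le_integral => //.
- by move=> w _; rewrite lee_fin nneg.
- exact: meas.
- exact: meas.
- by move=> w _; rewrite lee_fin indicT mulr1; exact: le.
Qed.

Lemma union_bound (J : finType) (B : set T) (F : J -> set T) :
  measurable B -> (forall j, measurable (F j)) ->
  (forall w, B w -> exists j, F j w) -> pr B <= \sum_j pr (F j).
Proof.
move=> mB mF BF.
(* With the empty index type [void], only the term of [B] remains on the left. *)
have := @sum_indic_le void J 1 0 0 1 B (fun=> set0) F.
rewrite !mul1r !mul0r add0r addr0; apply => // w.
rewrite mul1r mul0r addr0 add0r mul1r indicE.
case: (boolP (w \in B)) => [|_]; last by apply: sumr_ge0.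
rewrite inE => /BF[j Fj]; rewrite (bigD1 j)//= indicE mem_set//.
by rewrite lerDl sumr_ge0.
Qed.

Lemma markov_count (J : finType) (c : R) (B : set T) (F : J -> set T) :
  0 <= c -> measurable B -> (forall j, measurable (F j)) ->
  (forall w, B w -> c <= \sum_j \1_(F j) w) -> c * pr B <= \sum_j pr (F j).
Proof.
move=> c0 mB mF BF.
have := @sum_indic_le void J c 0 0 1 B (fun=> set0) F.
rewrite !mul1r !mul0r add0r addr0; apply => // w.
rewrite mul0r addr0 add0r mul1r indicE.
case: (boolP (w \in B)) => [|_]; last by rewrite mulr0 sumr_ge0.
by rewrite inE mulr1 => /BF.
Qed.

(* Chebyshev, from (c/2)^2 1_(Y <= c/2) <= (Y - c)^2 with both sides moved so
   that all coefficients are nonnegative. *)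
Lemma second_moment (I : finType) (p : R) (B : set T) (E : I -> set T) :
  measurable B -> (forall i, measurable (E i)) ->
  (forall i, pr (E i) = p) -> (forall i j, i != j -> pr (E i `&` E j) <= p ^+ 2) ->
  (forall w, B w -> \sum_i \1_(E i) w <= #|I|%:R * p / 2) ->
  #|I|%:R * p * pr B <= 4.
Proof.
move=> mB mE pE pEE BE; set c := #|I|%:R * p.
have p0 : forall i : I, 0 <= p by move=> i; rewrite -(pE i) pr_ge0.
have c0 : 0 <= c.
  rewrite /c; case: (posnP #|I|) => [->|/card_gt0P[i _]]; first by rewrite mul0r.
  by rewrite mulr_ge0// (p0 i).
have := @sum_indic_le I (I * I)%type (c ^+ 2 / 4) (2 * c) (c ^+ 2) 1 B E
  (fun ij => E ij.1 `&` E ij.2).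
have sE : \sum_i pr (E i) = c.
  by rewrite (eq_bigr (fun=> p))// sumr_const /c mulr_natl.
(* The diagonal contributes c in total, the remaining pairs at most c^2. *)
have sEE : \sum_ij pr (E ij.1 `&` E ij.2) <= c + c ^+ 2.
  rewrite -(pair_bigA _ (fun i j => pr (E i `&` E j)))/=.
  apply: (@le_trans _ _ (\sum_(i : I) (p + #|I|%:R * p ^+ 2))).
    apply: ler_sum => i _; rewrite (bigD1 i)//= setIid pE lerD2l.
    apply: (@le_trans _ _ (\sum_(j | j != i) p ^+ 2)).
      by apply: ler_sum => j ji; apply: pEE; rewrite eq_sym.
    rewrite sumr_const -[X in X <= _]mulr_natl ler_wpM2r ?sqr_ge0// ler_nat.
    by apply: max_card.
  by rewrite sumr_const -[X in X <= _]mulr_natl /c mulrDr lerD2l mulrA -expr2 exprMn.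
rewrite sE mul1r => H.
(* The terms 2 c^2 cancel, leaving (c^2 / 4) [pr B] <= c. *)
have {}H : c ^+ 2 / 4 * pr B + 2 * c * c <= c ^+ 2 + (c + c ^+ 2).
  apply: (le_trans (H _ _ _ _ _ _ _ _)) => //.
  - by rewrite divr_ge0// sqr_ge0.
  - by rewrite mulr_ge0.
  - by rewrite sqr_ge0.
  - by move=> ij; apply: measurableI.
  - move=> w; set Y : R := \sum_i _.
    have -> : \sum_(ij : I * I) \1_(E ij.1 `&` E ij.2) w = Y ^+ 2.
      rewrite -(pair_bigA _ (fun i j => \1_(E i `&` E j) w))/=.
      rewrite expr2 /Y mulr_suml; apply: eq_bigr => i _.
      by rewrite mulr_sumr; apply: eq_bigr => j _; rewrite indicI.
    rewrite mul1r indicE; case: (boolP (w \in B)) => [|_].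
      by rewrite inE mulr1 => /BE; exact: sqr_deviation_ge.
    rewrite mulr0 add0r -subr_ge0.
    have -> : c ^+ 2 + Y ^+ 2 - 2 * c * Y = (c - Y) ^+ 2.
      by rewrite [RHS]sqrrB -[c * Y *+ 2]mulr_natl mulrA addrAC.
    exact: sqr_ge0.
  - by rewrite lerD2l.
have [->|cn0] := eqVneq c 0; first by rewrite mul0r.
have cgt : 0 < c by rewrite lt_def cn0.
rewrite -(ler_pM2l cgt); move: H; move: (pr B) (c) => x y {}H.
by clear -H; nra.
Qed.

Lemma pr_partition (J : finType) (f : T -> J) (B : set T) : measurable B ->
  (forall j, measurable [set w | f w = j]) ->
  \sum_j pr ([set w | f w = j] `&` B) = pr B.
Proof.
move=> mB mf; have mfB j : measurable ([set w | f w = j] `&` B).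
  exact: measurableI.
have sumB w : \sum_j \1_([set w | f w = j] `&` B) w = \1_B w :> R.
  rewrite (bigD1 (f w))//= big1 => [|j jf]; last first.
    by rewrite indicE memNset// => -[/= e]; rewrite e eqxx in jf.
  by rewrite addr0 !indicE in_setI mem_set.
apply/le_anti/andP; split.
  have := @sum_indic_le J unit 0 1 0 1 set0 _ (fun=> B) (lexx _) ler01 (lexx _) ler01
    measurable0 mfB (fun=> mB).
  rewrite !mul0r !add0r !mul1r big_const card_unit /= addr0; apply => w.
  by rewrite mul0r !mul1r !add0r sumB big_const card_unit /= addr0.
have := @markov_count J 1 B _ ler01 mB mfB; rewrite mul1r; apply => w Bw.
by rewrite sumB indicE mem_set.
Qed.

End IndicatorInequalities.

(** * Measurability and independence in the model *)

Lemma measurable_exists_fin d (T : measurableType d) (I : finType)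
    (F : I -> set T) :
  (forall i, measurable (F i)) -> measurable [set x | exists i, F i x].
Proof.
move=> mF; have -> : [set x | exists i, F i x] = \bigcup_i F i.
  by apply/seteqP; split => [x [i Fi]|x [i _ Fi]]; exists i.
by apply: fin_bigcup_measurable => //; exact: finite_finset.
Qed.

Lemma measurable_forall_fin d (T : measurableType d) (I : finType)
    (F : I -> set T) :
  (forall i, measurable (F i)) -> measurable [set x | forall i, F i x].
Proof.
move=> mF; rewrite -[X in measurable X]setCK; apply: measurableC.
have -> : ~` [set x | forall i, F i x] = [set x | exists i, (~` F i) x].
  by apply/seteqP; split => x /existsNP.
by apply: measurable_exists_fin => i; exact: measurableC.
Qed.

Lemma measurable_bool_eq d (T : measurableType d) (b : T -> bool) (c : bool) :
  measurable [set x | b x] -> measurable [set x | b x = c].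
Proof.
case: c => // mb; have -> : [set x | b x = false] = ~` [set x | b x].
  by apply/seteqP; split => x /= => [->//|/negP/negbTE].
exact: measurableC.
Qed.

Section Model.
Variables (R : realType) (n : nat) (rs rd : R).

Lemma measurable_circle_dist_le (i j : 'I_n) (r : R) :
  measurable [set x : n.-tuple R | circle_dist (tnth x i) (tnth x j) <= r].
Proof.
have mt k : measurable_fun setT (fun x : n.-tuple R => tnth x k).
  exact: measurable_tnth.
have mabs : measurable_fun setT (fun x : n.-tuple R => `|tnth x i - tnth x j|).
  by apply: measurableT_comp => //; exact: measurable_funB.
have mf : measurable_fun setT
    (fun x : n.-tuple R => circle_dist (tnth x i) (tnth x j)).
  by apply: measurable_minr => //; exact: measurable_funB.
rewrite (_ : [set x : n.-tuple R | _] =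
    setT `&` (fun x => circle_dist (tnth x i) (tnth x j)) @^-1` `]-oo, r]).
  exact: mf.
by apply/seteqP; split => x /=; rewrite in_itv//= => -[].
Qed.

Lemma measurable_gbm_graph (A : {set 'I_n}) (g : graph n) :
  measurable [set x : n.-tuple R | gbm_graph rs rd A x = g].
Proof.
have -> : [set x : n.-tuple R | gbm_graph rs rd A x = g] =
    [set x | forall p, (p \in gbm_graph rs rd A x) = (p \in g)].
  by apply/seteqP; split => x /= => [-> //|/setP].
apply: measurable_forall_fin => p.
apply: measurable_bool_eq.
have [e|p12] := eqVneq p.1 p.2.
  rewrite (_ : [set x | _] = set0)//; apply/seteqP; split => x //=.
  by rewrite inE e eqxx.
rewrite (_ : [set x | _] = [set x : n.-tuple R | circle_dist (tnth x p.1)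
    (tnth x p.2) <= if (p.1 \in A) == (p.2 \in A) then rs else rd]).
  exact: measurable_circle_dist_le.
by apply/seteqP; split => x /=; rewrite inE p12.
Qed.

Variable M : gbm_model R n.
Notation P := (gbm_prob M).
Notation X := (@locations R n M).

Lemma measurable_locations : measurable_fun setT X.
Proof.
apply/measurable_fun_tnthP => i.
rewrite (_ : _ \o _ = loc M i); first exact: measurable_funPT.
by apply/funext => w; rewrite /= tnth_mktuple.
Qed.

Lemma measurable_preimage_locations (E : set (n.-tuple R)) :
  measurable E -> measurable (X @^-1` E).
Proof. by move=> mE; rewrite -[_ @^-1` _]setTI; exact: measurable_locations. Qed.

(** The model states independence separately for each value of the hidden part; summing over these
    values removes it. *)
Lemma pr_locations_box (B : 'I_n -> set R) : (forall u, measurable (B u)) ->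
  P [set w | forall u, B u (loc M u w)] = (\prod_(u < n) P (loc M u @^-1` B u))%E.
Proof.
move=> mB; set S := [set w | _].
have mloc u : measurable (loc M u @^-1` B u).
  by rewrite -[X in measurable X]setTI; exact: measurable_funPT.
have mS : measurable S by exact: measurable_forall_fin.
have mH := hidden_part_measurable M.
have prodE : (\prod_(u < n) P (loc M u @^-1` B u) =
    (\prod_(u < n) pr P (loc M u @^-1` B u))%:E)%E.
  by rewrite -prodEFin; apply: eq_bigr => u _; rewrite prE.
rewrite prodE (prE P mS) -(pr_partition P mS mH); congr (_%:E).
rewrite (eq_bigr (fun A => pr P ([set w | hidden_part w = A] `&` setT) *
    \prod_(u < n) pr P (loc M u @^-1` B u))) => [|A _].
  by rewrite -mulr_suml pr_partition// prT mul1r.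
apply: EFin_inj; rewrite setIT EFinM -!prE//; last exact: measurableI.
by rewrite part_loc_independent// prodE.
Qed.

(* The hidden part is independent of the vector of locations, not only of the
   boxes of the model: the boxes form a pi-system generating the product
   sigma-algebra. *)
Lemma hidden_part_independent (A : {set 'I_n}) (E : set (n.-tuple R)) :
  measurable E ->
  P ([set w | hidden_part w = A] `&` X @^-1` E) =
  (P [set w | hidden_part w = A] * P (X @^-1` E))%E.
Proof.
set H := [set w | _].
have mH : measurable H := hidden_part_measurable M A.
pose box := [set E : set (n.-tuple R) | exists2 B : 'I_n -> set R,
  (forall u, measurable (B u)) & E = [set x | forall u, B u (tnth x u)]].
have mbox : @measurable _ (n.-tuple R) = <<s box >>.
  apply/seteqP; split; last first.
    apply: smallest_sub; first exact: sigma_algebra_measurable.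
    move=> _ [B mB ->]; apply: measurable_forall_fin => u.
    by rewrite -[X in measurable X]setTI; exact: measurable_tnth.
  apply: smallest_sub; first exact: smallest_sigma_algebra.
  (* A generator of the product sigma-algebra constrains one coordinate, hence is a box whose other
     sides are full. *)
  rewrite -bigcup_seq; apply: bigcup_sub => i _ _ [B mB <-].
  apply: sub_sigma_algebra.
  exists (fun u => if u == i then B else setT) => [u|]; first by case: ifP.
  apply/seteqP; split => x /= => [[_ Bx] u|/(_ i)]; last by rewrite eqxx.
  by case: eqVneq => [->|].
rewrite mbox; move: E; apply: dynkin_induction => //=.
- move=> _ _ [B mB ->] [C mC ->]; exists (fun u => B u `&` C u).
    by move=> u; exact: measurableI.
  apply/seteqP; split => x /= => [[Bx Cx] u|BC]; first by split.
  by split => u; have [] := BC u.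
- by rewrite preimage_setT setIT probability_setT mule1.
- move=> _ [B mB ->].
  have XB : X @^-1` [set x | forall u, B u (tnth x u)] =
      [set w | forall u, B u (loc M u w)].
    by apply/seteqP; split => w /= Bw u; have := Bw u; rewrite tnth_mktuple.
  by rewrite XB part_loc_independent// pr_locations_box.
- move=> S mS IH; rewrite preimage_setC.
  have mXS := measurable_preimage_locations mS.
  rewrite probability_setC// -setDE measureD//; last first.
    by rewrite -ge0_fin_numE// fin_num_measure.
  by rewrite /= IH (prE P mH) (prE P mXS) -EFinM -!EFinB -EFinM mulrBr mulr1.
- move=> F mF tF IH; rewrite preimage_bigcup setI_bigcupr.
  have mXF k : measurable (X @^-1` F k).
    exact: measurable_preimage_locations.
  have tXF : trivIset setT (fun k => X @^-1` F k).
    move=> i j _ _ [w [Fi Fj]]; apply: tF => //; by exists (X w).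
  rewrite measure_semi_bigcup//; last 3 first.
  - by move=> k; exact: measurableI.
  - exact: trivIset_setIl.
  - by apply: bigcupT_measurable => k; exact: measurableI.
  rewrite measure_semi_bigcup//; last exact: bigcupT_measurable.
  rewrite (prE P mH) -nneseriesZl//.
  by apply: eq_eseriesr => k _; rewrite -(prE P mH); exact: IH.
Qed.

Section Decoding.
Variable alg : algorithm R n.
Notation Q := (seed_prob alg).

(** The event that the output would be right if the hidden part were [A]. It involves only the
    locations and the seed, hence is independent of the actual hidden part. *)
Definition decodes (A : {set 'I_n}) : set (n.-tuple R * seed_space alg) :=
  [set xs | run xs.1 (gbm_graph rs rd A xs.1) xs.2 = partition_of A].

Lemma measurable_decodes A : measurable (decodes A).
Proof.
have -> : decodes A = [set xs | exists g : graph n,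
    ([set x | gbm_graph rs rd A x = g] `*` setT `&`
    [set xs | run xs.1 g xs.2 = partition_of A]) xs].
  apply/seteqP; split => [xs dA|xs [g [[/= <- _]]]]//.
  by exists (gbm_graph rs rd A xs.1).
apply: measurable_exists_fin => g; apply: measurableI; last exact: run_measurable.
by apply: measurableX => //; exact: measurable_gbm_graph.
Qed.

Let XS := fun ws : gbm_space M * seed_space alg => (X ws.1, ws.2).

Lemma measurable_locations_seed (E : set (n.-tuple R * seed_space alg)) :
  measurable E -> measurable (XS @^-1` E).
Proof.
move=> mE; rewrite -[X in measurable X]setTI.
suff : measurable_fun setT XS by apply.
apply: measurable_fun_pair => //.
by apply: measurableT_comp => //; exact: measurable_locations.
Qed.

Definition success : set (gbm_space M * seed_space alg) :=
  [set ws | output rs rd ws.1 ws.2 = partition_of (hidden_part ws.1)].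

Lemma successE : success = [set ws | exists A,
  ([set w | hidden_part w = A] `*` setT `&` XS @^-1` decodes A) ws].
Proof.
apply/seteqP; split => [ws sw|ws [A [[/= <- _]]]]//.
by exists (hidden_part ws.1).
Qed.

Lemma measurable_success : measurable success.
Proof.
rewrite successE; apply: measurable_exists_fin => A; apply: measurableI.
  by apply: measurableX => //; exact: hidden_part_measurable.
by apply: measurable_locations_seed; exact: measurable_decodes.
Qed.

Lemma failure_probE : failure_prob rs rd M alg = (1 - success_prob rs rd M alg)%E.
Proof.
exact: (probability_setC (P \x Q)%E measurable_success).
Qed.

(** For each fixed seed this is [hidden_part_independent] applied to a section of [E]; integrating
    over the seed concludes. *)
Lemma hidden_part_seed_independent A (E : set (n.-tuple R * seed_space alg)) :
  measurable E ->
  (P \x Q)%E ([set w | hidden_part w = A] `*` setT `&` XS @^-1` E) =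
  (P [set w | hidden_part w = A] * (P \x Q) (XS @^-1` E))%E.
Proof.
move=> mE; set H := [set w | _]; have mH : measurable H := hidden_part_measurable M A.
have mXE := measurable_locations_seed mE.
(* The iterated integral is taken with the seed outermost, so that sections at a fixed seed
   appear. *)
have swap F : measurable F -> (P \x Q)%E F = (P \x^ Q)%E F.
  move=> mF; apply: product_measure_unique => // A1 A2 mA1 mA2.
  exact: product_measure2E.
rewrite !swap//; last by apply: measurableI => //; exact: measurableX.
rewrite /product_measure2 (prE P mH) -ge0_integralZl//; last 2 first.
- exact: measurable_fun_ysection.
- by rewrite lee_fin pr_ge0.
apply: eq_integral => s _ /=.
have -> : ysection (H `*` setT `&` XS @^-1` E) s = H `&` X @^-1` ysection E s.
  apply/seteqP; split => w; rewrite /ysection /= !inE /=.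
    by case=> -[].
  by case.
have -> : ysection (XS @^-1` E) s = X @^-1` ysection E s.
  by apply/seteqP; split => w; rewrite /ysection /= !inE.
rewrite hidden_part_independent ?(prE P mH)//.
exact: measurable_ysection.
Qed.

End Decoding.
End Model.

(** * Success bound for a uniform balanced partition *)

Lemma central_bin_ge m : (2 ^ m.*2 <= m.*2.+1 * 'C(m.*2, m))%N.
Proof.
elim: m => [|m IH]; first by rewrite bin0.
(* These give C(2m+2, m+1) = 2 C(2m+1, m) and (m+1) C(2m+1, m) = (2m+1) C(2m, m). *)
have h1 := mul_bin_diag m.*2.+2 m; have h2 := mul_bin_down m.*2.+1 m.
rewrite doubleS !expnS /= in h1 h2 *.
have e : (m.*2.+1 - m = m.+1)%N by lia.
rewrite {}e in h2; move: IH h1 h2.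
move: ('C(m.*2, m)) ('C(m.*2.+1, m)) ('C(m.*2.+2, m.+1)) (2 ^ _)%N => c d c' p.
move=> IH h1 h2; have {h1} -> : c' = d.*2.
  by apply/eqP; rewrite -(eqn_pmul2l (ltn0Sn m)) -h1; apply/eqP; lia.
nia.
Qed.

Lemma card_balanced m : #|[set A : {set 'I_m.*2} | balanced A]%SET| = 'C(m.*2, m).
Proof.
rewrite -[in RHS](card_ord m.*2) -card_draws; apply: eq_card => A.
by rewrite !inE; exact: (inj_eq double_inj).
Qed.

Section SuccessBound.
Variables (R : realType) (m : nat) (rs rd : R) (M : gbm_model R m.*2).
Variable alg : algorithm R m.*2.
Notation P := (gbm_prob M).
Notation Q := (seed_prob alg).
Notation X := (@locations R m.*2 M).
Hypothesis M_uniform : uniform_part M.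

(* Given the locations, all balanced partitions are equally likely, and of the
   partitions producing the same graph at most one is decoded correctly. *)
Lemma success_prob_le (bad : set (gbm_space M)) (k : nat) : measurable bad ->
  (forall w, ~ bad w ->
    (#|[set gbm_graph rs rd A (X w) | A : {set 'I_m.*2}]%SET| * 2 ^ k
       <= 2 ^ m.*2)%N) ->
  pr (P \x Q)%E (@success R m.*2 rs rd M alg) <=
  pr P bad + 2 * m.*2.+1%:R / 2 ^+ k.
Proof.
move=> mbad good.
pose C : R := 'C(m.*2, m)%:R.
have C0 : 0 < C by rewrite ltr0n bin_gt0; lia.
pose XS := fun ws : gbm_space M * seed_space alg => (X ws.1, ws.2).
(* Unbalanced sets get the empty event: they are never hidden, and at most [C] sets are then counted
   on [bad]. *)
pose E A := if balanced A then XS @^-1` decodes rs rd A else set0.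
have mE A : measurable (E A).
  rewrite /E; case: ifP => // _; apply: measurable_locations_seed.
  exact: measurable_decodes.
pose L : R := 2 * 2 ^+ m.*2 / 2 ^+ k.
(* Pointwise count of correctly decoded balanced sets: twice the number of graphs off [bad], at most
   [C] on it. *)
have bound : \sum_A pr (P \x Q)%E (E A) <= L + C * pr P bad.
  have badE : pr (P \x Q)%E (bad `*` setT) = pr P bad.
    transitivity (fine (P bad * Q setT)%E); last by rewrite probability_setT mule1.
    by congr fine; exact: product_measure1E.
  have := @sum_indic_le _ _ _ (P \x Q)%E _ unit 0 1 L C set0 E
    (fun=> bad `*` setT).
  rewrite mul0r add0r mul1r big_const card_unit /= addr0 badE; apply => //.
  - by rewrite /L divr_ge0// ?mulr_ge0// exprn_ge0.
  - by move=> _; exact: measurableX.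
  move=> ws; rewrite mul0r add0r mul1r big_const card_unit /= addr0.
  pose D := [set A | balanced A & run (X ws.1) (gbm_graph rs rd A (X ws.1)) ws.2
    == partition_of A]%SET.
  have -> : \sum_A \1_(E A) ws = #|D|%:R :> R.
    rewrite -sum1_card natr_sum [RHS]big_mkcond /=; apply: eq_bigr => A _.
    rewrite inE indicE /E; case: ifP => bA /=; last by rewrite in_set0.
    by case: eqP => eA; [rewrite mem_set | rewrite memNset].
  have [bw|bw] := pselect (bad ws.1).
    rewrite indicE mem_set ?mulr1//; apply: (@le_trans _ _ C).
      rewrite ler_nat -card_balanced subset_leq_card//.
      by apply/fintype.subsetP => A; rewrite !inE => /andP[].
    by rewrite lerDr /L divr_ge0// ?mulr_ge0// exprn_ge0.
  rewrite indicE memNset ?mulr0 ?addr0; last by move=> [].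
  rewrite /L ler_pdivlMr ?exprn_gt0// -!natrX -!natrM ler_nat.
  apply: leq_trans (_ : #|[set gbm_graph rs rd A (X ws.1) | A : {set 'I_m.*2}]%SET|.*2
    * 2 ^ k <= _)%N.
    rewrite leq_mul2r; apply/orP; right.
    apply: leq_trans (card_decoded _ (fun g => run (X ws.1) g ws.2)).
    by apply/subset_leq_card/fintype.subsetP => A; rewrite !inE => /andP[].
  by rewrite -mul2n -mulnA leq_mul2l good.
have mS := @measurable_success R m.*2 rs rd M alg.
have mHid A : measurable [set ws : gbm_space M * seed_space alg |
    hidden_part ws.1 = A].
  rewrite (_ : [set _ | _] = [set w | hidden_part w = A] `*` setT).
    by apply: measurableX => //; exact: hidden_part_measurable.
  by apply/seteqP; split => ws //= -[].
(* Each balanced set is hidden with probability 1/C, independently of whether it would be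
   decoded. *)
have -> : pr (P \x Q)%E (@success R m.*2 rs rd M alg) = C^-1 * \sum_A pr (P \x Q)%E (E A).
  rewrite -(pr_partition (P \x Q)%E mS mHid) mulr_sumr; apply: eq_bigr => A _.
  have -> : [set ws | hidden_part ws.1 = A] `&` @success R m.*2 rs rd M alg =
      [set w | hidden_part w = A] `*` setT `&` XS @^-1` decodes rs rd A.
    by apply/seteqP; split => ws /= [] => [<- ?|[<- _] ?].
  have mdec := @measurable_decodes R m.*2 rs rd alg A.
  transitivity (fine (P [set w | hidden_part w = A] *
      (P \x Q) (XS @^-1` decodes rs rd A))%E).
    by congr fine; exact: hidden_part_seed_independent mdec.
  rewrite /E; case: ifP => bA.
    have e : (P \x Q)%E (XS @^-1` decodes rs rd A) =
        (pr (P \x Q)%E (XS @^-1` decodes rs rd A))%:E.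
      by apply: prE; exact: measurable_locations_seed.
    by rewrite M_uniform// doubleK e.
  rewrite (_ : [set w | _] = set0); first by rewrite /pr !measure0 mul0e mulr0.
  apply/seteqP; split => w //= e.
  by have := hidden_part_balanced w; rewrite e bA.
rewrite mulrC ler_pdivrMr//; apply: (le_trans bound).
rewrite mulrDl addrC [C * _]mulrC lerD2l [leRHS]mulrAC /L ler_pM2r ?invr_gt0 ?exprn_gt0//.
rewrite -mulrA ler_pM2l// -natrX -natrM ler_nat.
exact: central_bin_ge.
Qed.

End SuccessBound.

(** * Cells of the circle *)

Lemma uniform_prob_itv (R : realType) (x y : R) : 0 <= x -> x <= y -> y <= 1 ->
  uniform_prob (@ltr01 R) `[x, y[ = (y - x)%:E.
Proof.
move=> x0 xy y1; rewrite /uniform_prob (eq_integral (cst 1%E)).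
  rewrite integral_cst//= mul1e lebesgue_measure_itv/= lte_fin -EFinD.
  by case: ltgtP xy => // -> _; rewrite subrr.
move=> z; rewrite inE /= in_itv /= => /andP[xz zy].
by rewrite /uniform_pdf (le_trans x0 xz) (le_trans (ltW zy) y1) subr0 invr1.
Qed.

Section Cells.
Variables (R : realType) (N : nat).
Hypothesis N_gt0 : (0 < N)%N.
Let N0 : (0 : R) < N%:R. Proof. by rewrite ltr0n. Qed.

Definition cell (i : nat) : set R := `[i%:R / N%:R, i.+1%:R / N%:R[.

Lemma cellP i x : cell i x <-> i%:R <= N%:R * x < i.+1%:R.
Proof.
by rewrite /cell /= in_itv /= ler_pdivrMr// ltr_pdivlMr// mulrC.
Qed.

Definition cell_of (x : R) : nat := Num.trunc (N%:R * x).

Lemma cell_cell_of x : 0 <= x -> cell (cell_of x) x.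
Proof. by move=> x0; apply/cellP/truncn_itv; rewrite mulr_ge0// ltW. Qed.

Lemma cell_ofE i x : cell i x -> cell_of x = i.
Proof. by move/cellP => h; exact: truncn_def. Qed.

Lemma cell_of_lt x : 0 <= x -> x < 1 -> (cell_of x < N)%N.
Proof.
move=> x0 x1; have Nx : 0 <= N%:R * x by rewrite mulr_ge0// ltW.
rewrite /cell_of truncn_lt_nat//.
by rewrite -[ltRHS]mulr1 ltr_pM2l.
Qed.

Definition cells (J : {set 'I_N}) : set R :=
  \big[setU/set0]_(i < N | i \in J) cell i.

Lemma cellsP J x : cells J x <-> exists2 i : 'I_N, i \in J & cell i x.
Proof.
rewrite /cells -bigcup_seq_cond /=; split => [[i /= /andP[_ iJ] ix]|[i iJ ix]].
  by exists i.
by exists i => //=; rewrite mem_index_enum iJ.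
Qed.

Lemma measurable_cells J : measurable (cells J).
Proof. by apply: bigsetU_measurable => i _; exact: measurable_itv. Qed.

Lemma uniform_prob_cells J :
  uniform_prob (@ltr01 R) (cells J) = (#|J|%:R / N%:R)%:E.
Proof.
rewrite /cells measure_bigsetU_ord; last 2 first.
- by move=> i; exact: measurable_itv.
- move=> i j _ _ [x [/cell_ofE xi /cell_ofE xj]].
  by apply: val_inj; rewrite /= -xi -xj.
rewrite (eq_bigr (fun=> (N%:R^-1 : R)%:E)) => [|i _].
  by rewrite sumEFin sumr_const mulr_natl.
have h1 : 0 <= i%:R / N%:R :> R by rewrite divr_ge0.
have h2 : i%:R / N%:R <= i.+1%:R / N%:R :> R.
  by rewrite ler_pM2r ?invr_gt0// ler_nat.
have h3 : i.+1%:R / N%:R <= 1 :> R by rewrite ler_pdivrMr// mul1r ler_nat.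
apply: etrans (uniform_prob_itv h1 h2 h3) _.
by rewrite -mulrBl -natrB// subSnn mul1r.
Qed.

Variables (n : nat) (M : gbm_model R n).
Notation P := (gbm_prob M).

Definition avoid (J : {set 'I_N}) : set (gbm_space M) :=
  [set w | forall u, ~ cells J (loc M u w)].

Lemma measurable_avoid J : measurable (avoid J).
Proof.
apply: measurable_forall_fin => u; apply: measurableC.
by rewrite -[X in measurable X]setTI; apply: measurable_funPT => //;
  exact: measurable_cells.
Qed.

Lemma pr_avoid J : pr P (avoid J) = (1 - #|J|%:R / N%:R) ^+ n.
Proof.
have mC := measurableC (measurable_cells J).
have e : P (avoid J) = (\prod_(u < n) P (loc M u @^-1` (~` cells J)))%E.
  exact: (pr_locations_box M (B := fun=> ~` cells J) (fun=> mC)).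
rewrite /pr e (eq_bigr (fun=> (1 - #|J|%:R / N%:R)%:E)) => [|u _].
  by rewrite prodEFin prodr_const card_ord.
rewrite loc_uniform// probability_setC; last exact: measurable_cells.
by rewrite EFinB -uniform_prob_cells.
Qed.

(** An event of probability one on which every vertex has a cell; the endpoint 1 is left out because
    its cell index would be [N]. *)
Definition in_circle : set (gbm_space M) :=
  [set w | forall u, 0 <= loc M u w < 1].

Lemma in_circleE : in_circle = [set w | forall u, `[0, 1[%classic (loc M u w)].
Proof. by apply/seteqP; split => w h u; have := h u; rewrite /= in_itv. Qed.

Lemma measurable_in_circle : measurable in_circle.
Proof.
rewrite in_circleE; apply: measurable_forall_fin => u.
by rewrite -[X in measurable X]setTI; apply: measurable_funPT => //;
  exact: measurable_itv.
Qed.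

Lemma pr_in_circle : pr P in_circle = 1.
Proof.
rewrite in_circleE /pr.
have e : P [set w | forall u, `[0, 1[%classic (loc M u w)] =
    (\prod_(u < n) P (loc M u @^-1` `[0%R, 1%R[))%E.
  by apply: (pr_locations_box M (B := fun=> `[0, 1[%classic)) => u; exact: measurable_itv.
rewrite e big1// => u _; rewrite loc_uniform; last exact: measurable_itv.
by rewrite uniform_prob_itv// subr0.
Qed.

End Cells.
Arguments avoid {R N n} M J.
Arguments in_circle {R n} M.

(** * Recovery from informative pairs *)

Section Informative.
Variables (R : realType) (n : nat) (rs rd : R).

(* The pairs whose adjacency reveals whether they lie in the same part. *)
Definition informative (x : n.-tuple R) : rel 'I_n :=
  fun u v => rd < circle_dist (tnth x u) (tnth x v) <= rs.

Lemma circle_distC (y z : R) : circle_dist y z = circle_dist z y.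
Proof. by rewrite /circle_dist distrC. Qed.

Lemma informative_sym x : symmetric (informative x).
Proof. by move=> u v; rewrite /informative circle_distC. Qed.

Lemma same_part_informative (A B : {set 'I_n}) x u v : rd < rs ->
  gbm_graph rs rd A x = gbm_graph rs rd B x -> informative x u v ->
  ((u \in A) == (v \in A)) = ((u \in B) == (v \in B)).
Proof.
move=> rds /setP/(_ (u, v)); rewrite !inE /= => e /andP[rduv uvrs].
have [->|uv] := eqVneq u v; first by rewrite !eqxx.
move: e; rewrite uv /=; do 2 case: (_ == _) => //.
  by rewrite uvrs => /esym; rewrite leNgt rduv.
by rewrite uvrs leNgt rduv.
Qed.

Lemma same_part_connected (A B : {set 'I_n}) x u v : rd < rs ->
  gbm_graph rs rd A x = gbm_graph rs rd B x -> connect (informative x) u v ->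
  ((u \in A) == (v \in A)) = ((u \in B) == (v \in B)).
Proof.
move=> rds AB /connectP[s]; elim: s u => [|w s IH] u /=.
  by move=> _ ->; rewrite !eqxx.
move=> /andP[uw ws] lv; have := IH w ws lv; have := same_part_informative rds AB uw.
by do 6 case: (_ \in _).
Qed.

(** Equal graphs agree on the relation of being in the same part along informative pairs, hence
    everywhere by connectivity; so [B] is [A] or its complement. *)
Lemma connected_partition_unique (A B : {set 'I_n}) x : rd < rs ->
  (forall u v, connect (informative x) u v) ->
  gbm_graph rs rd A x = gbm_graph rs rd B x -> partition_of A = partition_of B.
Proof.
move=> rds conn AB; have same u v := same_part_connected rds AB (conn u v).
case: (pickP (fun u : 'I_n => (u \in A) != (u \in B))) => [u uAB|AeB].
  have -> : B = (~: A)%SET.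
    apply/setP => v; rewrite inE; have := same u v; move: uAB.
    by do 4 case: (_ \in _).
  by rewrite /partition_of finset.setCK finset.setUC.
by congr partition_of; apply/setP => u; have /negbFE/eqP := AeB u.
Qed.

End Informative.

Section ConsistentAlgorithm.
Variables (R : realType) (n : nat) (rs rd : R).

(** Any set explaining the graph is accepted. On graphs of the model the hidden part is one, so the
    default [set0] does not occur there. *)
Definition consistent_run (x : n.-tuple R) (g : graph n) (s : unit) :=
  partition_of (odflt finset.set0 [pick A | gbm_graph rs rd A x == g]).

Lemma consistent_run_measurable (g : graph n) (c : {set {set 'I_n}}) :
  measurable [set xs : n.-tuple R * unit | consistent_run xs.1 g xs.2 = c].
Proof.
(* The output depends on [x] only through the finite family of graphs of all candidate sets, so the
   event is a finite union of measurable level sets. *)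
pose graphs (x : n.-tuple R) : {ffun {set 'I_n} -> graph n} :=
  [ffun A => gbm_graph rs rd A x].
pose dec (phi : {ffun {set 'I_n} -> graph n}) :=
  partition_of (odflt finset.set0 [pick A | phi A == g]).
have decE x : consistent_run x g tt = dec (graphs x).
  congr (partition_of (odflt _ _)); apply: eq_pick => A.
  by rewrite ffunE.
have -> : [set xs : n.-tuple R * unit | consistent_run xs.1 g xs.2 = c] =
    [set x | exists phi : {phi | dec phi == c}, graphs x = val phi] `*` setT.
  apply/seteqP; split => -[x []] /=.
    rewrite decE => /eqP e; split => //; by exists (exist _ (graphs x) e).
  move=> [[phi /= e] _]; rewrite decE e; exact: (eqP (valP phi)).
apply: measurableX => //; apply: measurable_exists_fin => phi.
rewrite [X in measurable X](_ : _ =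
    [set x | forall A, gbm_graph rs rd A x = val phi A]).
  by apply: measurable_forall_fin => A; exact: measurable_gbm_graph.
apply/seteqP; split => x /= => [<- A|e]; first by rewrite ffunE.
by apply/ffunP => A; rewrite ffunE.
Qed.

Definition consistent_algorithm : algorithm R n :=
  Algorithm \d_tt consistent_run_measurable.

Variable M : gbm_model R n.
Notation P := (gbm_prob M).

Lemma consistent_success_ge (bad : set (gbm_space M)) : rd < rs ->
  measurable bad ->
  (forall w, ~ bad w ->
     forall u v, connect (informative rs rd (locations w)) u v) ->
  1 - pr P bad <=
  pr (P \x seed_prob consistent_algorithm)%E
    (@success R n rs rd M consistent_algorithm).
Proof.
move=> rds mbad good; rewrite -prC//.
have mgood := measurableC mbad.
have -> : pr P (~` bad) =
    pr (P \x seed_prob consistent_algorithm)%E (~` bad `*` setT).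
  transitivity (fine (P (~` bad) * seed_prob consistent_algorithm setT)%E).
    by rewrite probability_setT mule1.
  by congr fine; apply/esym; exact: product_measure1E.
apply: le_pr; [exact: measurableX|exact: measurable_success|].
move=> [w s] [/= bw _]; rewrite /success /= /output /= /consistent_run.
case: pickP => [A /eqP eA|/(_ (hidden_part w))]; last by rewrite eqxx.
exact: connected_partition_unique rds (good w bw) eA.
Qed.

End ConsistentAlgorithm.

(** * Connectivity of the informative pairs with high probability *)

Lemma circle_dist_cells (R : realType) (N p q t i j : nat) (rs rd x y : R) :
  (i < N)%N -> cell N i x -> cell N j y -> j = ((i + t) %% N)%N ->
  (0 < p)%N -> (p <= t <= q)%N -> (q.+1.*2 <= N)%N ->
  N%:R * rd <= p.-1%:R -> q.+1%:R <= N%:R * rs ->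
  rd < circle_dist x y <= rs.
Proof.
move=> iN xi yj ej p0 /andP[pt tq] qN hrd hrs.
have N0 : (0 : R) < N%:R by rewrite ltr0n; lia.
have N_gt0 : (0 < N)%N by lia.
move: xi yj => /(cellP N_gt0)/andP[xi xi'] /(cellP N_gt0)/andP[yj yj'].
suff : N%:R * rd < N%:R * circle_dist x y <= N%:R * rs.
  by rewrite ltr_pM2l// ler_pM2l.
have -> : N%:R * circle_dist x y =
    Num.min `|N%:R * x - N%:R * y| (N%:R - `|N%:R * x - N%:R * y|).
  rewrite /circle_dist minr_pMr ?ltW// mulrBr mulr1 -mulrBr.
  by rewrite normrM (gtr0_norm N0).
move: (N%:R * x) (N%:R * y) (N%:R * rd) (N%:R * rs) xi xi' yj yj' hrd hrs.
move=> X Y rd' rs'; rewrite lt_min ge_min.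
(* Points in cells t apart have scaled distance between t - 1 and t + 1 along one arc; this bound on
   [N] keeps the other arc longer than p - 1. The case split below is whether the shift passes the
   origin. *)
have rN : (2 * q.+1%:R <= N%:R :> R) by rewrite -natrM ler_nat mul2n.
have rp : p.-1%:R + 1 <= t%:R :> R.
  by rewrite natr1 prednK// ler_nat.
have rq : t%:R + 1 <= q.+1%:R :> R by rewrite natr1 ler_nat.
have t1 : 1 <= t%:R :> R by rewrite ler1n; lia.
have [itN|Nit] := ltnP (i + t) N.
  have {ej} -> : j = (i + t)%N by rewrite ej modn_small.
  rewrite -!natr1 !natrD => xi xi' yj yj' hrd hrs.
  have -> : `|X - Y| = Y - X by rewrite distrC ger0_norm//; lra.
  by apply/andP; split; [apply/andP; split|apply/orP; left]; lra.
have ijt : (i + t = j + N)%N.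
  have -> : j = (i + t - N)%N; last by rewrite subnK.
  by rewrite ej -[in LHS](subnK Nit) modnDr modn_small//; lia.
have rij : i%:R + t%:R = j%:R + N%:R :> R by rewrite -!natrD ijt.
rewrite -!natr1 => xi xi' yj yj' hrd hrs.
have -> : `|X - Y| = X - Y by rewrite ger0_norm//; lra.
by apply/andP; split; [apply/andP; split|apply/orP; right]; lra.
Qed.

Section Crowded.
Variables (R : realType) (N p q D n : nat) (rs rd : R) (M : gbm_model R n).
Notation P := (gbm_prob M).
Notation W := (window q D).
Hypotheses (p_gt0 : (0 < p)%N) (lt_pq : (p < q)%N) (le_Dq : (D <= q)%N).
Hypotheses (D_le_steps : (D <= (q - p).+1.*2)%N) (WN : (W <= N)%N).
Hypotheses (qN : (q.+1.*2 <= N)%N).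
Hypotheses (hrd : N%:R * rd <= p.-1%:R) (hrs : q.+1%:R <= N%:R * rs).

Let N_gt0 : (0 < N)%N. Proof. by apply: leq_trans qN; rewrite double_gt0. Qed.

Definition shifted (z : nat) (J : {set 'I_W}) : {set 'I_N} :=
  [set i : 'I_N | [exists t in J, ((z + t) %% N)%N == i]]%SET.

Lemma card_shifted z J : #|shifted z J| = #|J|.
Proof.
pose f (t : 'I_W) := Ordinal (ltn_pmod (z + t) N_gt0).
have finj : injective f.
  move=> t t' /(congr1 val)/= e; apply: val_inj => /=.
  have : t = t' %[mod N] by apply/eqP; rewrite -(eqn_modDl z); apply/eqP.
  by rewrite !modn_small ?(leq_trans _ WN).
rewrite -(card_imset J finj); apply: eq_card => i; rewrite inE.
apply/idP/imsetP => [/exists_inP[t tJ /eqP e]|[t tJ ->]].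
  by exists t => //; apply: val_inj.
by apply/exists_inP; exists t.
Qed.

(** One event for each window start and each choice of [D] empty cells. Other sizes give the empty
    event, so the union bound runs over all pairs and costs a factor N 2^W. *)
Definition sparse_cells (zJ : 'I_N * {set 'I_W}) : set (gbm_space M) :=
  if #|zJ.2| == D then avoid M (shifted zJ.1 zJ.2) else set0.

Lemma measurable_sparse_cells zJ : measurable (sparse_cells zJ).
Proof. by rewrite /sparse_cells; case: ifP => // _; exact: measurable_avoid. Qed.

Definition sparse_fail : set (gbm_space M) :=
  [set w | exists zJ, sparse_cells zJ w].

Definition circle_fail : set (gbm_space M) := ~` in_circle M `|` sparse_fail.

Lemma measurable_sparse_fail : measurable sparse_fail.
Proof. by apply: measurable_exists_fin => zJ; exact: measurable_sparse_cells. Qed.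

Lemma measurable_circle_fail : measurable circle_fail.
Proof.
apply: measurableU; last exact: measurable_sparse_fail.
by apply: measurableC; exact: measurable_in_circle.
Qed.

Lemma pr_circle_fail :
  pr P circle_fail <= N%:R * 2 ^+ W * (1 - D%:R / N%:R) ^+ n.
Proof.
have DN : (D <= N)%N.
  apply: leq_trans le_Dq (leq_trans _ qN).
  by rewrite -addnn (leq_trans (leqnSn _))// leq_addr.
have r0 : (0 : R) <= 1 - D%:R / N%:R.
  by rewrite subr_ge0 ler_pdivrMr ?ltr0n// mul1r ler_nat.
have := @union_bound _ _ _ P bool circle_fail
  (fun b => if b then ~` in_circle M else sparse_fail).
rewrite big_bool /= prC; last exact: measurable_in_circle.
rewrite pr_in_circle subrr add0r => H; apply: (le_trans (H _ _ _)).
- exact: measurable_circle_fail.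
- case; first by apply: measurableC; exact: measurable_in_circle.
  exact: measurable_sparse_fail.
- by move=> w [] ?; [exists true|exists false].
apply: (le_trans (union_bound P (F := sparse_cells) measurable_sparse_fail
    measurable_sparse_cells _)) => //.
apply: (@le_trans _ _ (\sum_(zJ : 'I_N * {set 'I_W}) (1 - D%:R / N%:R) ^+ n)).
  apply: ler_sum => zJ _; rewrite /sparse_cells; case: ifP => [/eqP e|_].
    by rewrite pr_avoid// card_shifted e.
  by rewrite /pr measure0 exprn_ge0.
rewrite sumr_const card_prod card_ord -[X in X <= _]mulr_natl natrM.
have -> : #|{: {set 'I_W}}| = (2 ^ W)%N.
  by rewrite -cardsT -powersetT card_powerset cardsT card_ord.
by rewrite natrX.
Qed.

Lemma circle_connected w : ~ circle_fail w ->
  forall u v, connect (informative rs rd (locations w)) u v.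
Proof.
move=> /not_orP[/contrapT inC nfail] u v.
have in0 i : 0 <= loc M i w by have /andP[] := inC i.
have in1 i : loc M i w < 1 by have /andP[] := inC i.
pose kappa i := cell_of N (loc M i w).
have kN i : (kappa i < N)%N by exact: cell_of_lt.
apply: (@all_connected _ _ N kappa p q D) => //.
- exact: informative_sym.
- move=> i j t tpq kij; rewrite /informative !tnth_mktuple.
  by apply: (circle_dist_cells (kN i) _ _ kij p_gt0 tpq qN hrd hrs);
    exact: cell_cell_of.
(* [D] empty cells in the window at [z] would witness [sparse_fail] at z mod N. *)
- move=> z; rewrite ltnNge; apply/negP => /card_geqP[s [us sD sub]].
  apply: nfail; pose J : {set 'I_W} := [set t in s]%SET.
  have JD : #|J| = D by rewrite cardsE (card_uniqP us).
  exists (Ordinal (ltn_pmod z N_gt0), J); rewrite /sparse_cells /= JD eqxx => i.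
  move=> /cellsP[j + jx]; rewrite inE => /exists_inP[t].
  rewrite inE => /sub; rewrite inE => /existsPn /(_ i) + /eqP/= e.
  by rewrite /lies_at /kappa (cell_ofE N_gt0 jx) -e modnDml eqxx.
Qed.

End Crowded.

(** * Holes in disjoint blocks of cells *)

Section Blocks.
Variables (R : realType) (n N W B : nat) (M : gbm_model R n).
Variables (S : {set 'I_W}) (c : 'I_W).
Notation P := (gbm_prob M).
Hypotheses (W_gt0 : (0 < W)%N) (N_gt0 : (0 < N)%N) (BW : (B * W <= N)%N).
Hypothesis cS : c \notin S.

Lemma block_cell_lt (i : 'I_B) (t : 'I_W) : (i * W + t < N)%N.
Proof.
apply: leq_trans BW; apply: (@leq_trans (i.+1 * W)).
  by rewrite mulSn addnC ltn_add2r.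
by rewrite leq_mul2r ltn_ord orbT.
Qed.

Definition block_cell (i : 'I_B) (t : 'I_W) : 'I_N :=
  Ordinal (block_cell_lt i t).

Lemma block_cell_inj i i' t t' :
  block_cell i t = block_cell i' t' -> i = i' /\ t = t'.
Proof.
move=> /(congr1 val)/= e; split; apply: val_inj => /=.
  by have := congr1 (divn^~ W) e; rewrite !divnMDl// !divn_small// !addn0.
by have := congr1 (modn^~ W) e; rewrite !modnMDl !modn_small.
Qed.

Definition placed (i : 'I_B) (J : {set 'I_W}) : {set 'I_N} :=
  [set block_cell i t | t in J]%SET.

Lemma card_placed i J : #|placed i J| = #|J|.
Proof. by rewrite card_imset// => t t' /block_cell_inj[]. Qed.

Lemma avoid_placed i J w : avoid M (placed i J) w <->
  forall u t, t \in J -> ~ cell N (i * W + t) (loc M u w).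
Proof.
split=> [av u t tJ ct|h u /cellsP[j /imsetP[t tJ ->] ct]]; last exact: h ct.
by apply: (av u); apply/cellsP; exists (block_cell i t) => //; exact: imset_f.
Qed.

Let s := #|S|.
Let hole : R := (1 - s%:R / N%:R) ^+ n.
Let mean : R := #|'I_B|%:R * hole.
Let E i := avoid M (placed i S).
Let E' i := avoid M (placed i (c |: S)).

Let s_lt (i : 'I_B) : (s.+1 <= N)%N.
Proof.
have -> : s.+1 = #|placed i (c |: S)%SET|.
  by rewrite card_placed cardsU1 cS.
by rewrite -[leqRHS](card_ord N) max_card.
Qed.

(** [E i] makes block i empty on [S], [E' i] makes its cell [c] empty too, and [mean] is the
    expected number of the former. Outside both events, more than [mean / 4] blocks are empty on [S]
    but occupied at [c]. *)
Definition few_holes : set (gbm_space M) :=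
  [set w | \sum_i \1_(E i) w <= mean / 2].
Definition many_large_holes : set (gbm_space M) :=
  [set w | mean / 4 <= \sum_i \1_(E' i) w].
Definition few_good_blocks := few_holes `|` many_large_holes.

Let mE i : measurable (E i). Proof. exact: measurable_avoid. Qed.
Let mE' i : measurable (E' i). Proof. exact: measurable_avoid. Qed.

Let msum (F : 'I_B -> set (gbm_space M)) : (forall i, measurable (F i)) ->
  measurable_fun setT (fun w => \sum_i \1_(F i) w : R).
Proof.
by move=> mF; apply: measurable_sum => i; exact: measurable_indic.
Qed.

Lemma measurable_few_holes : measurable few_holes.
Proof.
rewrite (_ : few_holes = setT `&`
    (fun w => \sum_i \1_(E i) w : R) @^-1` `]-oo, (mean / 2)]).
  exact: msum.
by apply/seteqP; split => w /=; rewrite /few_holes in_itv//= => -[].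
Qed.

Lemma measurable_many_large_holes : measurable many_large_holes.
Proof.
rewrite (_ : many_large_holes = setT `&`
    (fun w => \sum_i \1_(E' i) w : R) @^-1` `[(mean / 4), +oo[).
  exact: msum.
by apply/seteqP; split => w /=; rewrite /many_large_holes in_itv/= ?andbT// => -[].
Qed.

Lemma measurable_few_good_blocks : measurable few_good_blocks.
Proof.
apply: measurableU; first exact: measurable_few_holes.
exact: measurable_many_large_holes.
Qed.

Let cell_frac (k : nat) : R := k%:R / N%:R.
Let frac_ge0 k : 0 <= cell_frac k. Proof. by rewrite divr_ge0. Qed.
Let frac_le1 k : (k <= N)%N -> cell_frac k <= 1.
Proof. by move=> kN; rewrite ler_pdivrMr ?ltr0n// mul1r ler_nat. Qed.

Lemma pr_few_holes : mean * pr P few_holes <= 4.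
Proof.
apply: (@second_moment _ _ _ P _ hole few_holes E) => //.
- exact: measurable_few_holes.
- by move=> i; rewrite pr_avoid// card_placed.
(* Holes in disjoint blocks are negatively correlated: 1 - 2s/N <= (1 - s/N)^2. *)
- move=> i j ij.
  have -> : E i `&` E j = avoid M (placed i S :|: placed j S)%SET.
    apply/seteqP; split => [w [wi wj] u /cellsP[k]|w ww].
      rewrite inE => /orP[ki|kj] ku.
        by apply: (wi u); apply/cellsP; exists k.
      by apply: (wj u); apply/cellsP; exists k.
    by split => u /cellsP[k kS ku]; apply: (ww u); apply/cellsP; exists k;
      rewrite // inE kS ?orbT.
  rewrite pr_avoid// cardsU (_ : (_ :&: _)%SET = finset.set0); last first.
    apply/setP => k; rewrite !inE; apply/negP => /andP[].
    move=> /imsetP[t _ ->] /imsetP[t' _ /block_cell_inj[e _]].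
    by rewrite e eqxx in ij.
  rewrite cards0 subn0 !card_placed /hole -exprM mulnC exprM.
  have s2N : (s + s <= N)%N.
    have e : #|(placed i S :|: placed j S)%SET| = (s + s)%N.
      rewrite cardsU !card_placed (_ : (_ :&: _)%SET = finset.set0) ?cards0 ?subn0//.
      apply/setP => k; rewrite !inE; apply/negP => /andP[].
      move=> /imsetP[t _ ->] /imsetP[t' _ /block_cell_inj[e _]].
      by rewrite e eqxx in ij.
    by rewrite -e -[leqRHS](card_ord N) max_card.
  apply: lerXn2r; rewrite ?nnegrE ?sqr_ge0// ?subr_ge0 ?frac_le1//.
  rewrite natrD mulrDl -/(cell_frac s); have := frac_ge0 s; nra.
Qed.

(** One further empty cell costs a factor (1 - 1/N)^n, because 1 - (s+1)/N <= (1 - s/N)(1 - 1/N);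
    then Markov. *)
Lemma pr_many_large_holes : 0 < mean ->
  pr P many_large_holes <= 4 * (1 - 1 / N%:R) ^+ n.
Proof.
move=> mean0.
have i0 : exists i : 'I_B, true.
  case: (posnP B) => [B0|B0]; last by exists (Ordinal B0).
  by move: mean0; rewrite /mean card_ord B0 mul0r ltxx.
have [i00 _] := i0; have sN := s_lt i00.
have := @markov_count _ _ _ P _ (mean / 4) many_large_holes E'.
move=> /(_ (ltW _) measurable_many_large_holes mE' _) H.
have {}H : mean / 4 * pr P many_large_holes <= \sum_i pr P (E' i).
  by apply: H => //; rewrite divr_gt0.
have e1 : cell_frac s.+1 = cell_frac s + cell_frac 1.
  by rewrite /cell_frac -natr1 mulrDl.
have le1 : \sum_i pr P (E' i) <= mean * (1 - 1 / N%:R) ^+ n.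
  rewrite /mean -mulrA mulr_natl -sumr_const; apply: ler_sum => i _.
  rewrite pr_avoid// card_placed cardsU1 cS /= add1n /hole -exprMn.
  apply: lerXn2r; rewrite ?nnegrE ?mulr_ge0 ?subr_ge0 ?(frac_le1)//.
  - exact: ltnW.
  - by apply: (frac_le1 (k := 1)).
  rewrite -/(cell_frac s.+1) -/(cell_frac s) -/(cell_frac 1) e1.
  have := frac_ge0 s; have := frac_ge0 1; nra.
have := le_trans H le1; rewrite -mulrA ler_pM2l// ler_pdivrMl//.
Qed.

Lemma pr_few_good_blocks : 0 < mean ->
  pr P few_good_blocks <= 4 / mean + 4 * (1 - 1 / N%:R) ^+ n.
Proof.
move=> mean0; have := @union_bound _ _ _ P bool few_good_blocks
  (fun b => if b then few_holes else many_large_holes).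
rewrite big_bool /= => H; apply: (le_trans (H _ _ _)).
- exact: measurable_few_good_blocks.
- by case; [exact: measurable_few_holes|exact: measurable_many_large_holes].
- by move=> w [] ?; [exists true|exists false].
apply: lerD; last exact: pr_many_large_holes.
by rewrite ler_pdivlMr// mulrC pr_few_holes.
Qed.

Lemma good_blocks (K : nat) w : 4 * K%:R <= mean -> ~ few_good_blocks w ->
  exists2 I : {set 'I_B}, (K <= #|I|)%N & forall i, i \in I ->
    (forall u t, t \in S -> ~ cell N (i * W + t) (loc M u w)) /\
    (exists u, cell N (i * W + c) (loc M u w)).
Proof.
move=> Kmean /not_orP[fh ml].
pose I := [set i : 'I_B | `[< E i w /\ ~ E' i w >] ]%SET.
exists I; last first.
  move=> i; rewrite inE => /asboolP[/avoid_placed Ei nE']; split => //.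
  apply: contrapT => nu; apply: nE'; apply/avoid_placed => u t.
  rewrite !inE => /orP[/eqP-> cu|]; last exact: Ei.
  by apply: nu; exists u.
have {fh}fh : mean / 2 < \sum_i \1_(E i) w by rewrite ltNge; apply/negP.
have {ml}ml : \sum_i \1_(E' i) w < mean / 4 by rewrite ltNge; apply/negP.
have -> : (K <= #|I|)%N = (K%:R <= #|I|%:R :> R) by rewrite ler_nat.
(* Since [E' i] is contained in [E i], the difference of the two counts is the number of good
   blocks. *)
have -> : #|I|%:R = \sum_i \1_(E i) w - \sum_i \1_(E' i) w :> R.
  rewrite -sumrB -sum1_card natr_sum big_mkcond /=; apply: eq_bigr => i _.
  rewrite !indicE inE; have EE' : E' i w -> E i w.
    by move=> /avoid_placed h; apply/avoid_placed => u t tS;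
      apply: h; rewrite !inE tS orbT.
  have [e'|e'] := pselect (E' i w).
    have e := EE' e'; rewrite !mem_set// subrr.
    by case: asboolP => // -[].
  rewrite [w \in E' i]memNset// subr0.
  have [e|e] := pselect (E i w); first by rewrite mem_set// asboolT.
  by rewrite memNset// asboolF// => -[].
lra.
Qed.

End Blocks.

(** * Vertex sets that can be flipped without changing the graph *)

Lemma gbm_graph_flip (R : realType) (n : nat) (rs rd : R) (S A : {set 'I_n})
    (x : n.-tuple R) : rd <= rs ->
  (forall u v, informative rs rd x u v -> (u \in S) = (v \in S)) ->
  gbm_graph rs rd (flip S A) x = gbm_graph rs rd A x.
Proof.
move=> rds Scl; apply/setP => -[u v]; rewrite !inE /=; congr (_ && _).
(* The ends of an informative pair are flipped together or not at all; any other pair is adjacent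
   for both radii or for neither. *)
have [/andP[rduv uvrs]|/negP ninf] := boolP (informative rs rd x u v).
  have -> : (u \in S) = (v \in S) by apply: Scl; apply/andP.
  by do 3 case: (_ \in _).
have [le_rd|lt_rd] := leP (circle_dist (tnth x u) (tnth x v)) rd.
  by do 2 case: ifP; rewrite ?le_rd ?(le_trans le_rd rds).
have lt_rs : circle_dist (tnth x u) (tnth x v) <= rs = false.
  by apply/negP => le_rs; apply: ninf; rewrite /informative lt_rd.
by do 2 case: ifP; rewrite ?lt_rs ?leNgt ?lt_rd.
Qed.

Lemma card_graphs_le (R : realType) (n B k : nat) (rs rd : R)
    (x : n.-tuple R) (I : {set 'I_B}) (F : 'I_B -> {set 'I_n}) :
  rd <= rs -> (k <= #|I|)%N ->
  (forall i, i \in I -> F i != finset.set0) ->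
  (forall i j u, i \in I -> j \in I -> u \in F i -> u \in F j -> i = j) ->
  (forall i u v, i \in I -> informative rs rd x u v -> u \in F i -> v \in F i) ->
  (#|[set gbm_graph rs rd A x | A : {set 'I_n}]%SET| * 2 ^ k <= 2 ^ n)%N.
Proof.
move=> rds kI F0 Fdis Fcl.
apply: (@leq_trans (#|[set gbm_graph rs rd A x | A : {set 'I_n}]%SET| * 2 ^ #|I|)).
  by rewrite leq_mul2l leq_exp2l// kI orbT.
rewrite -[in leqRHS](card_ord n).
have -> : #|I| = #|{: {i | i \in I}}| by rewrite card_sig; apply: eq_card.
apply: (card_flip_invariant (F := fun i : {i | i \in I} => F (val i))).
- by move=> [i iI]; exact: F0.
- move=> [i iI] [j jI] ij; apply/pred0P => u /=; apply/negP => /andP[ui uj].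
  by move/eqP: ij; apply; apply: val_inj; exact: Fdis ui uj.
- move=> J A; apply: gbm_graph_flip => // u v uv.
  have cl u' v' : informative rs rd x u' v' ->
      u' \in (\bigcup_(i in J) F (val i))%SET -> v' \in (\bigcup_(i in J) F (val i))%SET.
    move=> uv' /finset.bigcupP[i iJ ui]; apply/finset.bigcupP; exists i => //.
    by apply: Fcl uv' ui; exact: valP.
  by apply/idP/idP; apply: cl; rewrite // informative_sym.
Qed.

(** Offset [hi] is the middle of a block of 2 hi + 1 cells; the two ranges of t are the cells at
    index distance from [lo] to [hi] on either side of it. *)
Lemma annulus_offset (x lo hi ku kv : nat) : (ku = x + hi)%N ->
  (kv <= ku + hi)%N -> (ku <= kv + hi)%N ->
  (ku + lo <= kv)%N \/ (kv + lo <= ku)%N ->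
  exists2 t, (t + lo <= hi)%N || (hi + lo <= t <= hi.*2)%N & kv = (x + t)%N.
Proof.
by move=> -> h1 h2 [h|h]; exists (kv - x)%N; lia.
Qed.

Section Free.
Variables (R : realType) (n N B K : nat) (rs rd : R) (M : gbm_model R n).
Variable w : gbm_space M.
Hypotheses (N_gt0 : (0 < N)%N) (rds : rd <= rs) (inC : in_circle M w).
Let kappa u := cell_of N (loc M u w).

Let in0 u : 0 <= loc M u w. Proof. by have /andP[] := inC u. Qed.
Let kN u : (kappa u < N)%N.
Proof. by have /andP[? ?] := inC u; exact: cell_of_lt. Qed.
Let kcell u : cell N (kappa u) (loc M u w). Proof. exact: cell_cell_of. Qed.
Let N0 : (0 : R) < N%:R. Proof. by rewrite ltr0n. Qed.

Let scaled u : R := N%:R * loc M u w.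
Let scaled_lt u : scaled u < N%:R.
Proof.
by have /andP[_ u1] := inC u; rewrite /scaled -[ltRHS]mulr1 ltr_pM2l.
Qed.
Let scaled_ge0 u : 0 <= scaled u. Proof. by rewrite /scaled mulr_ge0// ltW. Qed.
Let scaledP u : (kappa u)%:R <= scaled u < (kappa u).+1%:R.
Proof. exact/(cellP N_gt0). Qed.

Let dist u v := circle_dist (tnth (locations w) u) (tnth (locations w) v).
Let distE u v : N%:R * dist u v =
  Num.min `|scaled u - scaled v| (N%:R - `|scaled u - scaled v|).
Proof.
rewrite /dist !tnth_mktuple /circle_dist minr_pMr ?ltW// mulrBr mulr1.
by rewrite /scaled -mulrBr normrM (gtr0_norm N0).
Qed.

(** Away from both ends of the unit interval, the arc through the origin is too long to matter. *)
Lemma wrap_far (h : nat) u v :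
  (h <= kappa u)%N -> (kappa u + h < N)%N ->
  h%:R < N%:R - `|scaled u - scaled v|.
Proof.
rewrite -addSn -!(ler_nat R) natrD => hu uh.
have /andP[u1 u2] := scaledP u; have v1 := scaled_lt v; have v2 := scaled_ge0 v.
rewrite ltrBrDl -ltrBrDr ltr_norml; apply/andP; split; lra.
Qed.

(** [F i] holds the vertices of the middle cell of block i. An informative partner of one of them
    would lie in an annulus of that block, and these are empty. *)
Lemma free_annuli (lo hi : nat) (I : {set 'I_B}) :
  (B * hi.*2.+1 <= N)%N -> lo%:R <= N%:R * rd -> N%:R * rs <= hi%:R ->
  (K <= #|I|)%N ->
  (forall i, i \in I ->
    (forall u (t : nat), (t + lo <= hi)%N || (hi + lo <= t <= hi.*2)%N ->
        ~ cell N (i * hi.*2.+1 + t) (loc M u w)) /\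
    (exists u, cell N (i * hi.*2.+1 + hi) (loc M u w))) ->
  (#|[set gbm_graph rs rd A (locations w) | A : {set 'I_n}]%SET| * 2 ^ K
     <= 2 ^ n)%N.
Proof.
move=> BN Nrd Nrs KI good.
pose F (i : 'I_B) := [set u | kappa u == i * hi.*2.+1 + hi]%N%SET.
apply: (@card_graphs_le _ _ _ _ _ _ _ I F) => //.
- move=> i iI; have [_ [u cu]] := good i iI; apply/set0Pn; exists u.
  by rewrite inE /kappa (cell_ofE N_gt0 cu).
- move=> i j u _ _; rewrite !inE => /eqP-> /eqP e; apply: val_inj => /=.
  have := congr1 (divn^~ hi.*2.+1) e.
  by rewrite !divnMDl// !divn_small// ?addn0; lia.
move=> i u v iI /andP[ruv uvr]; rewrite !inE => /eqP ku.
have [empty _] := good i iI.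
have iB : (i.+1 * hi.*2.+1 <= N)%N.
  by apply: leq_trans BN; rewrite leq_mul2r ltn_ord orbT.
rewrite mulSn in iB.
have far : hi%:R < N%:R - `|scaled u - scaled v| by apply: wrap_far; lia.
have duv : N%:R * rd < `|scaled u - scaled v| <= N%:R * rs.
  have r1 : N%:R * rd < N%:R * dist u v by rewrite ltr_pM2l.
  have r2 : N%:R * dist u v <= N%:R * rs by rewrite ler_pM2l.
  move: r1 r2; rewrite distE lt_min ge_min => /andP[-> _] /orP[-> //|h].
  by have := lt_le_trans far (le_trans h Nrs); rewrite ltxx.
have /andP[u1 u2] := scaledP u; have /andP[v1 v2] := scaledP v.
exfalso; move: duv => /andP[d1 d2].
(* Index differences and scaled distances differ by less than one: distance at most [hi] gives index
   difference at most [hi], and distance above [lo] gives at least [lo]. *)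
have near1 : (kappa v <= kappa u + hi)%N.
  rewrite -ltnS -(ltr_nat R) -natr1 natrD.
  have := ler_norm (scaled v - scaled u); rewrite distrC.
  rewrite -natr1 in u2; lra.
have near2 : (kappa u <= kappa v + hi)%N.
  rewrite -ltnS -(ltr_nat R) -natr1 natrD.
  have := ler_norm (scaled u - scaled v).
  rewrite -natr1 in v2; lra.
have away : (kappa u + lo <= kappa v)%N \/ (kappa v + lo <= kappa u)%N.
  move: d1; rewrite ltr_normr => /orP[d|d].
    right; rewrite -ltnS -(ltr_nat R) -natr1 natrD.
    rewrite -[in ltRHS]natr1 in u2 *; lra.
  left; rewrite -ltnS -(ltr_nat R) -natr1 natrD.
  rewrite -[in ltRHS]natr1 in v2 *; lra.
have [t tS ekv] := annulus_offset ku near1 near2 away.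
by apply: (empty v t tS); rewrite -ekv.
Qed.

(** [F i] runs from the occupied cell that ends block i to the next gap of s empty cells, which no
    pair within r_s can cross. The last block is dropped, as its arc would continue past the origin;
    hence K < [#|I|]. *)
Lemma free_arcs (s : nat) (I : {set 'I_B}) :
  (B * s.+1 <= N)%N -> N%:R * rs <= s%:R -> (K < #|I|)%N ->
  (forall i, i \in I ->
    (forall u (t : nat), (t < s)%N -> ~ cell N (i * s.+1 + t) (loc M u w)) /\
    (exists u, cell N (i * s.+1 + s) (loc M u w))) ->
  (#|[set gbm_graph rs rd A (locations w) | A : {set 'I_n}]%SET| * 2 ^ K
     <= 2 ^ n)%N.
Proof.
move=> BN Nrs KI good.
pose F (i : 'I_B) := [set u | (i * s.+1 + s <= kappa u)%N &&
  [forall j in I, (i < j)%N ==> (kappa u < j * s.+1)%N]]%SET.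
pose I' := [set i in I | [exists j in I, (i < j)%N]]%SET.
have gap (i : 'I_B) u : i \in I -> (kappa u < i * s.+1 + s)%N -> (kappa u < i * s.+1)%N.
  move=> iI ku; rewrite ltnNge; apply/negP => iu.
  have [empty _] := good i iI.
  apply: (empty u (kappa u - i * s.+1)%N); first by lia.
  by rewrite subnKC.
have step (i j : 'I_B) : (i < j)%N -> (i * s.+1 + s < j * s.+1)%N.
  move=> ij; apply: (@leq_trans (i.+1 * s.+1)); last by rewrite leq_mul2r ij orbT.
  by rewrite mulSn addnC addSn.
have FP (i : 'I_B) u : reflect ((i * s.+1 + s <= kappa u)%N /\
    forall j, j \in I -> (i < j)%N -> (kappa u < j * s.+1)%N) (u \in F i).
  rewrite inE; apply: (iffP andP) => -[-> h]; split=> //.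
    by move=> j jI ij; move/forall_inP: h => /(_ j jI)/implyP; exact.
  by apply/forall_inP => j jI; apply/implyP => ij; exact: h.
apply: (@card_graphs_le _ _ _ _ _ _ _ I' F) => //.
- have [i0 i0I] : exists i, i \in I by apply/card_gt0P; exact: leq_ltn_trans KI.
  pose top := [arg max_(i > i0 in I) val i].
  (* Only the largest index of [I] is missing from [I']. *)
  have IU : I \subset (top |: I')%SET.
    apply/fintype.subsetP => i iI; rewrite !inE iI /=.
    rewrite /top; case: arg_maxnP => // j jI jmax.
    have [//|ij] := eqVneq i j; apply/existsP; exists j; rewrite jI /=.
    by rewrite ltn_neqAle -val_eqE in ij *; rewrite ij; exact: jmax.
  rewrite -ltnS; apply: (leq_trans KI); apply: (leq_trans (subset_leq_card IU)).
  by rewrite cardsU1; case: (_ \notin _); rewrite ?add1n ?add0n.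
- move=> i; rewrite inE => /andP[iI _]; have [_ [u cu]] := good i iI.
  apply/set0Pn; exists u; apply/FP; rewrite /kappa (cell_ofE N_gt0 cu).
  by split => // j jI ij; exact: step.
- move=> i j u /finset.setIdP[iI _] /finset.setIdP[jI _] /FP[iu hi] /FP[ju hj].
  apply: val_inj; case: (ltngtP i j) => // ij.
    by have := hi j jI ij; lia.
  by have := hj i iI ij; lia.
move=> i u v; rewrite inE => /andP[iI /existsP[j0 /andP[j0I ij0]]].
move=> /andP[_ uvr] /FP[iu hu]; apply/FP.
have uj0 := hu j0 j0I ij0.
have j0N : (j0.+1 * s.+1 <= N)%N.
  by apply: leq_trans BN; rewrite leq_mul2r ltn_ord orbT.
rewrite mulSn in j0N.
have far : s%:R < N%:R - `|scaled u - scaled v| by apply: wrap_far; lia.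
have duv : `|scaled u - scaled v| <= s%:R.
  have : N%:R * dist u v <= N%:R * rs by rewrite ler_pM2l.
  rewrite distE ge_min => /orP[h|h]; first exact: le_trans h Nrs.
  by have := lt_le_trans far (le_trans h Nrs); rewrite ltxx.
have /andP[u1 u2] := scaledP u; have /andP[v1 v2] := scaledP v.
have near1 : (kappa v <= kappa u + s)%N.
  rewrite -ltnS -(ltr_nat R) -natr1 natrD.
  have := ler_norm (scaled v - scaled u); rewrite distrC.
  rewrite -natr1 in u2; lra.
have near2 : (kappa u <= kappa v + s)%N.
  rewrite -ltnS -(ltr_nat R) -natr1 natrD.
  have := ler_norm (scaled u - scaled v).
  rewrite -natr1 in v2; lra.
(* A jump of at most s cells cannot pass a whole gap: leaving the arc, [v] would land in the empty
   cells. *)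
have before x : (x + s <= kappa u)%N -> (x <= kappa v)%N.
  by move=> xu; rewrite -(leq_add2r s); exact: leq_trans near2.
have after x : (x + s <= kappa v)%N -> (x <= kappa u)%N.
  by move=> xv; rewrite -(leq_add2r s); exact: leq_trans near1.
split.
  by rewrite leqNgt; apply/negP => /(gap _ _ iI); rewrite ltnNge before.
move=> j jI ij; have uj := hu j jI ij; rewrite ltnNge; apply/negP => jv.
have /after : (j * s.+1 + s <= kappa v)%N.
  by rewrite leqNgt; apply/negP => /(gap _ _ jI); rewrite ltnNge jv.
by rewrite leqNgt uj.
Qed.

End Free.

(** * Asymptotics *)

Lemma exprn_1B_le (R : realType) (z : R) (n : nat) : 0 <= z -> z <= 1 ->
  (1 - z) ^+ n <= expR (- (n%:R * z)).
Proof.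
move=> z0 z1; rewrite -mulrN expRM_natl lerXn2r ?nnegrE ?subr_ge0 ?expR_ge0//.
exact: expR_ge1Dx.
Qed.

(** The reciprocal 1/(1 - z) = 1 + z/(1 - z) is at most exp(z/(1 - z)). *)
Lemma exprn_1B_ge (R : realType) (z : R) (n : nat) : 0 <= z -> z < 1 ->
  expR (- (n%:R * (z / (1 - z)))) <= (1 - z) ^+ n.
Proof.
move=> z0 z1; have z2 : 0 < 1 - z by rewrite subr_gt0.
rewrite -mulrN expRM_natl lerXn2r ?nnegrE ?expR_ge0 ?(ltW z2)//.
rewrite expRN -[leRHS]invrK lef_pV2 ?posrE ?expR_gt0 ?invr_gt0//.
apply: le_trans (expR_ge1Dx _); rewrite le_eqVlt; apply/orP; left.
by apply/eqP; field; rewrite gt_eqF.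
Qed.

Lemma expRN_le_inv (R : realType) (z : R) : 0 < z -> expR (- z) <= z^-1.
Proof.
move=> z0; rewrite expRN lef_pV2 ?posrE ?expR_gt0//.
by apply: le_trans (expR_ge1Dx _); rewrite lerDr.
Qed.

Section Asymptotics.
Variable R : realType.

Definition logn2 (m : nat) : R := ln m.*2%:R.
(** With n = 2m, the radius c log n / n is c / [scale], about c D cells when the circle is cut into
    [ncells]. *)
Definition scale (m : nat) : R := m.*2%:R / logn2 m.
Definition ncells (D m : nat) : nat := Num.trunc (D%:R * scale m).

Lemma near_logn2 (C : R) : \forall m \near \oo, C <= logn2 m.
Proof.
exists (Num.trunc (expR C)).+1 => // m /= mC.
have h : expR C <= m.*2%:R.
  apply: (le_trans (ltW (truncnS_gt _))); rewrite ler_nat.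
  by apply: leq_trans mC _; rewrite -addnn leq_addr.
have m0 : (0 : R) < m.*2%:R by apply: lt_le_trans h; exact: expR_gt0.
by rewrite /logn2 -[leLHS]expRK ler_ln ?posrE ?expR_gt0.
Qed.

Lemma expR_logn2 m : 1 <= logn2 m -> expR (logn2 m) = m.*2%:R.
Proof.
move=> L1; rewrite /logn2 lnK// posrE ltr0n lt0n; apply/eqP => m0.
by move: L1; rewrite /logn2 m0 ln0//; lra.
Qed.

Lemma scale_gt0 m : 1 <= logn2 m -> 0 < scale m.
Proof.
move=> L1; rewrite divr_gt0//; last lra.
by rewrite -expR_logn2// expR_gt0.
Qed.

Lemma scale_ge m : 1 <= logn2 m -> logn2 m / 2 <= scale m.
Proof.
move=> L1; rewrite /scale ler_pdivlMr; last lra.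
have L0 : 0 <= logn2 m by lra.
have := expR_ge1Dxn 1 L0; rewrite expR_logn2//=.
by move: (logn2 m) => L; rewrite /factorial /=; lra.
Qed.

Lemma near_scale (C : R) : \forall m \near \oo, C <= scale m.
Proof.
near=> m; have L1 : 1 <= logn2 m by near: m; exact: near_logn2.
apply: le_trans (scale_ge L1); rewrite ler_pdivlMr//.
by near: m; exact: near_logn2.
Unshelve. all: by end_near. Qed.

Lemma ncells_bounds D m : 1 <= logn2 m ->
  D%:R * scale m - 1 < (ncells D m)%:R <= D%:R * scale m.
Proof.
move=> L1; have y0 := scale_gt0 L1.
have /andP[h1 h2] : (ncells D m)%:R <= D%:R * scale m < (ncells D m).+1%:R.
  by apply: truncn_itv; rewrite mulr_ge0// ltW.
by rewrite h1 andbT ltrBlDr natr1.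
Qed.

Lemma log_radiusE c m : 1 <= logn2 m -> log_radius c m.*2 = c / scale m.
Proof. by move=> L1; rewrite /log_radius /scale invf_div mulrA. Qed.

Lemma ncells_div_le D m : 1 <= logn2 m ->
  (ncells D m)%:R / m.*2%:R <= D%:R / logn2 m.
Proof.
move=> L1; have /andP[_ h] := ncells_bounds D L1.
have n0 : (0 : R) < m.*2%:R by rewrite -expR_logn2// expR_gt0.
by rewrite ler_pdivrMr// mulrAC -mulrA.
Qed.

(** As N <= D n / log n, one has (1 - D/N)^n <= exp(- n D / N) <= 1/n. *)
Lemma sparse_bound D W m : 1 <= logn2 m -> (0 < D)%N -> (D <= ncells D m)%N ->
  (ncells D m)%:R * 2 ^+ W * (1 - D%:R / (ncells D m)%:R) ^+ m.*2
    <= D%:R * 2 ^+ W / logn2 m.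
Proof.
move=> L1 D0 DN; set N := ncells D m in DN *.
have N0 : (0 : R) < N%:R by rewrite ltr0n; lia.
have n0 : (0 : R) < m.*2%:R by rewrite -expR_logn2// expR_gt0.
have L0 : 0 < logn2 m by lra.
have hNn := ncells_div_le D L1; rewrite -/N in hNn.
have hexp : (1 - D%:R / N%:R) ^+ m.*2 <= m.*2%:R^-1 :> R.
  have z0 : 0 <= D%:R / N%:R :> R by rewrite divr_ge0.
  have z1 : D%:R / N%:R <= 1 :> R by rewrite ler_pdivrMr// mul1r ler_nat.
  apply: (le_trans (exprn_1B_le m.*2 z0 z1)).
  rewrite -[in leRHS](expR_logn2 L1) -expRN ler_expR lerN2.
  rewrite mulrA ler_pdivlMr// -ler_pdivlMl// mulrA mulrC.
  by move: hNn; rewrite ler_pdivrMr// mulrA.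
apply: (@le_trans _ _ (N%:R * 2 ^+ W / m.*2%:R)).
  by apply: ler_wpM2l => //; rewrite mulr_ge0// exprn_ge0.
by rewrite mulrAC [leRHS]mulrAC ler_wpM2r// exprn_ge0.
Qed.

(** Here (1 - 1/N)^n <= exp(- n/N) <= N/n. *)
Lemma hole_bound D m : 1 <= logn2 m -> (0 < ncells D m)%N ->
  (1 - 1 / (ncells D m)%:R) ^+ m.*2 <= D%:R / logn2 m.
Proof.
move=> L1 N0; set N := ncells D m in N0 *.
have N0' : (0 : R) < N%:R by rewrite ltr0n.
have n0 : (0 : R) < m.*2%:R by rewrite -expR_logn2// expR_gt0.
apply: le_trans (ncells_div_le D L1).
have z0 : 0 <= 1 / N%:R :> R by rewrite divr_ge0.
have z1 : 1 / N%:R <= 1 :> R by rewrite ler_pdivrMr// mul1r ler1n.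
apply: (le_trans (exprn_1B_le m.*2 z0 z1)); rewrite mul1r.
have nN0 : (0 : R) < m.*2%:R / N%:R by rewrite divr_gt0.
by apply: (le_trans (expRN_le_inv nN0)); rewrite invf_div.
Qed.

(* The expected number of holes is at least of order n^theta / log n, where
   theta = 1 / (2 s + 1). *)
Lemma mean_ge D W s m : 1 <= logn2 m -> (s < D)%N -> (0 < W)%N ->
  2 * (1 + s%:R) <= scale m -> 2 * (1 + W%:R) <= scale m ->
  (2 * s%:R + 1)^-1 ^+ 3 * logn2 m ^+ 2 / (12 * W%:R) <=
  (ncells D m %/ W)%:R * (1 - s%:R / (ncells D m)%:R) ^+ m.*2.
Proof.
move=> L1 sD W0 ys yW; set N := ncells D m; set L := logn2 m in L1 *.
have /andP[N1 _] := ncells_bounds D L1; rewrite -/N in N1.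
have y0 := scale_gt0 L1; set y := scale m in y0 ys yW N1.
have n0 : (0 : R) < m.*2%:R by rewrite -expR_logn2// expR_gt0.
have L0 : 0 < L by lra.
have sD' : s%:R + 1 <= D%:R :> R by rewrite natr1 ler_nat.
have s0 : 0 <= s%:R :> R by [].
have W0' : 1 <= W%:R :> R by rewrite ler1n.
(* N > D y - 1 >= (s + 1) y - 1, and y >= 2 (1 + s) absorbs both the rounding and the subtracted
   s. *)
have Ns : (s%:R + 2^-1) * y <= N%:R - s%:R.
  have : (s%:R + 1) * y <= D%:R * y by rewrite ler_pM2r.
  rewrite !mulrDl; lra.
have Ns0 : 0 < N%:R - s%:R :> R.
  by apply: lt_le_trans Ns; rewrite mulr_gt0//; lra.
have N0 : 0 < N%:R :> R by lra.
have nyL : m.*2%:R = y * L by rewrite /y /scale -/L divfK// gt_eqF.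
(* Since s / (s + 1/2) = 1 - theta, a hole has probability at least n^(theta - 1). *)
have hole : expR (- L) * expR (L * (2 * s%:R + 1)^-1) <=
    (1 - s%:R / N%:R) ^+ m.*2.
  have z0 : 0 <= s%:R / N%:R :> R by rewrite divr_ge0// ltW.
  have z1 : s%:R / N%:R < 1 :> R by rewrite ltr_pdivrMr// mul1r; lra.
  apply: le_trans (exprn_1B_ge m.*2 z0 z1).
  rewrite -expRD ler_expR.
  have -> : s%:R / N%:R / (1 - s%:R / N%:R) = s%:R / (N%:R - s%:R) :> R.
    by field; rewrite !gt_eqF.
  have -> : - L + L * (2 * s%:R + 1)^-1 = - (L * (s%:R / (s%:R + 2^-1))).
    by field; rewrite gt_eqF//=; lra.
  rewrite lerN2 nyL mulrA ler_pdivrMr// mulrA -[leLHS]mulr1.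
  have s2 : 0 < s%:R + 2^-1 :> R by lra.
  rewrite [leRHS]mulrAC ler_pdivlMr// mulr1.
  have : y * L * s%:R * (s%:R + 2^-1) = L * s%:R * ((s%:R + 2^-1) * y) by ring.
  by move=> ->; rewrite ler_wpM2l// mulr_ge0// ltW.
have blocks : y / (2 * W%:R) <= (N %/ W)%:R.
  have : (N %/ W).+1%:R * W%:R >= N%:R :> R.
    by rewrite -natrM ler_nat ltnW// ltn_ceil.
  rewrite ler_pdivrMr; last lra.
  have D1 : 1 <= D%:R :> R by lra.
  have : y <= D%:R * y by rewrite ler_peMl// ltW.
  rewrite -natr1 mulrDl; lra.
apply: (@le_trans _ _ (y / (2 * W%:R) *
    (expR (- L) * expR (L * (2 * s%:R + 1)^-1)))); last first.
  apply: ler_pM => //; apply: divr_ge0; [exact: ltW|exact: mulr_ge0].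

set theta : R := (2 * s%:R + 1)^-1.
have theta0 : 0 < theta by rewrite invr_gt0; lra.
have yE : y * expR (- L) = L^-1.
  rewrite expRN (expR_logn2 L1) nyL; field.
  by rewrite !gt_eqF.
have -> : y / (2 * W%:R) * (expR (- L) * expR (L * theta)) =
    y * expR (- L) * expR (L * theta) / (2 * W%:R) by ring.
rewrite {}yE.
(* Bounding n^theta below by its cubic term leaves order L^2 after the division by L. *)
have cube : (L * theta) ^+ 3 / 6 <= expR (L * theta).
  have Lt : 0 <= L * theta by rewrite mulr_ge0// ltW.
  by have := expR_ge1Dxn 2 Lt; rewrite /factorial /=; lra.
apply: (@le_trans _ _ (L^-1 * ((L * theta) ^+ 3 / 6) / (2 * W%:R))).
  rewrite le_eqVlt; apply/orP; left; apply/eqP; field.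
  by rewrite !gt_eqF//=; lra.
apply: ler_wpM2r; first by rewrite invr_ge0; lra.
by apply: ler_wpM2l => //; rewrite invr_ge0 ltW.
Qed.

End Asymptotics.

Lemma cvg_EFin_dist (R : realType) (f : nat -> R) (l : R) :
  (forall eps : R, 0 < eps -> \forall m \near \oo, `|l - f m| <= eps) ->
  (f m)%:E @[m --> \oo] --> l%:E.
Proof.
move=> h; apply: cvg_EFin; first exact: nearW.
by apply/cvgrPdist_le => eps; exact: h.
Qed.

(** * Exact recovery above the thresholds *)

Section Recovery.
Variables (R : realType) (a b : R).
Hypotheses (hb : 0 <= b) (hab : b < a).

Let lt_radius m : 1 <= logn2 R m ->
  log_radius b m.*2 < log_radius a m.*2.
Proof.
move=> L1; rewrite !log_radiusE// ltr_pM2r// invr_gt0.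
exact: scale_gt0.
Qed.

Lemma recovery_constants : 1 / 2 < a - b -> 1 < a ->
  exists D p q : nat, [/\ (0 < D)%N, (0 < p)%N, (p < q)%N, (D <= q)%N &
    [/\ (D <= (q - p).+1.*2)%N, b * D%:R <= p.-1%:R & q.+1%:R < a * D%:R]].
Proof.
move=> hab2 a1.
have [D [D4 D2 D3]] : exists D, [/\ (1 < D)%N, 1 < (a - 1) * D%:R &
    4 < (a - b - 1 / 2) * D%:R].
  pose D := (Num.trunc ((a - 1)^-1 + 4 * (a - b - 1 / 2)^-1)).+2.
  exists D; have D1 : (a - 1)^-1 + 4 * (a - b - 1 / 2)^-1 < D%:R.
    by apply: (lt_trans (truncnS_gt _)); rewrite ltr_nat /D.
  have a0 : 0 < a - 1 by lra.
  have ab0 : 0 < a - b - 1 / 2 by lra.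
  have a10 : 0 < (a - 1)^-1 by rewrite invr_gt0.
  have ab10 : 0 < (a - b - 1 / 2)^-1 by rewrite invr_gt0.
  split => //; first by rewrite -ltr_pdivrMl// mulr1; lra.
  by rewrite -ltr_pdivrMl// mulrC; lra.
have [p [p0 p1 p2]] : exists p, [/\ (0 < p)%N, b * D%:R <= p.-1%:R &
    p%:R <= b * D%:R + 2].
  exists (Num.trunc (b * D%:R)).+2; split => //; first exact/ltW/truncnS_gt.
  have := truncn_le (b * D%:R); rewrite mulr_ge0// => pD.
  by rewrite -addn2 natrD lerD2r.
(* q >= D gives enough residues and q >= p + D/2 enough first steps; a > 1 and a - b > 1/2
   respectively keep q + 1 below a D. *)
exists D, p, (maxn D (D./2 + p)).
have nats : [/\ (p < maxn D (D./2 + p))%N, (D <= maxn D (D./2 + p))%N,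
    (D <= (maxn D (D./2 + p) - p).+1.*2)%N & ((D./2).*2 <= D)%N].
  by clear -D4 p0; split; lia.
have [? ? ? D5'] := nats; split => //; first exact: ltnW.
split => //.
have D5 : (D./2)%:R * 2 <= D%:R :> R by rewrite -natrM ler_nat muln2.
clear nats D5'.
have [_|_] := leqP D (D./2 + p); rewrite -natr1 ?natrD; nra.
Qed.

Lemma exact_recovery : 1 / 2 < a - b -> 1 < a ->
  exists alg : forall m : nat, algorithm R m.*2,
  forall M : forall m : nat, gbm_model R m.*2,
    success_prob (log_radius a m.*2) (log_radius b m.*2) (M m) (alg m)
      @[m --> \oo] --> 1%E.
Proof.
move=> hab2 a1; have [D [p [q [D0 p0 pq Dq [Dpq bp qa]]]]] := recovery_constants hab2 a1.
pose alg m : algorithm R m.*2 :=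
  consistent_algorithm m.*2 (log_radius a m.*2) (log_radius b m.*2).
exists alg => M.
pose f m := pr (gbm_prob (M m) \x seed_prob (alg m))%E
  (@success R m.*2 (log_radius a m.*2) (log_radius b m.*2) (M m) (alg m)).
rewrite (_ : (fun m => _) = fun m => (f m)%:E); last first.
  by apply/funext => m; apply: prE; exact: measurable_success.
apply: cvg_EFin_dist => eps eps0.
near=> m.
have f1 : f m <= 1 by apply: pr_le1; exact: measurable_success.
rewrite ger0_norm ?subr_ge0// lerBlDr addrC -lerBlDr.
have L1 : 1 <= logn2 R m by near: m; exact: near_logn2.
have y0 := scale_gt0 L1; have /andP[N1 N2] := ncells_bounds D L1.
set N := ncells R D m in N1 N2.
have D1 : 1 <= D%:R :> R by rewrite ler1n.
have Nbig : (window q D + q.+1.*2 <= N)%N.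
  have y1 : (window q D + q.+1.*2)%:R + 1 <= scale R m.
    by near: m; exact: near_scale.
  have : scale R m <= D%:R * scale R m by rewrite ler_peMl// ltW.
  rewrite -(ler_nat R); lra.
have Nrd : N%:R * log_radius b m.*2 <= p.-1%:R.
  rewrite log_radiusE// mulrA ler_pdivrMr//.
  have : N%:R * b <= D%:R * scale R m * b by rewrite ler_wpM2r.
  have : b * D%:R * scale R m <= p.-1%:R * scale R m by rewrite ler_pM2r.
  lra.
have Nrs : q.+1%:R <= N%:R * log_radius a m.*2.
  rewrite log_radiusE// mulrA ler_pdivlMr//.
  have a0 : 0 < a by lra.
  have : (D%:R * scale R m - 1) * a <= N%:R * a by rewrite ler_pM2r// ltW.
  (* Rounding [N] down costs at most a, outweighed by the slack in q + 1 < a D once [scale] is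
     large. *)
  have : a <= (a * D%:R - q.+1%:R) * scale R m.
    rewrite -ler_pdivrMl ?subr_gt0//.
    by near: m; exact: near_scale.
  lra.
have WN : (window q D <= N)%N := leq_trans (leq_addr _ _) Nbig.
have qN : (q.+1.*2 <= N)%N := leq_trans (leq_addl _ _) Nbig.
have := consistent_success_ge (M := M m) (lt_radius L1)
  (measurable_circle_fail N q D (M m)) 
  (circle_connected p0 pq Dq Dpq qN Nrd Nrs).
rewrite -/(f m); apply: le_trans; rewrite lerD2l lerN2.
apply: le_trans (pr_circle_fail (M m) Dq WN qN) _.
apply: le_trans (sparse_bound (window q D) L1 D0 _) _.
  by apply: leq_trans Dq (leq_trans _ qN); clear; lia.
have L0 : 0 < logn2 R m by lra.
rewrite ler_pdivrMr// [leRHS]mulrC -ler_pdivrMr//.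
by near: m; exact: near_logn2.
Unshelve. all: by end_near. Qed.

End Recovery.

(** * Failure below the thresholds *)

Section Failure.
Variables (R : realType) (a b : R) (D W : nat) (S : {set 'I_W}) (c : 'I_W).
Hypotheses (SD : (#|S| < D)%N) (cS : c \notin S).

(** Chosen so that 2^k >= n^2, making 2 (n + 1) / 2^k of order 1/n, while k stays of order log n. *)
Definition flips_needed (m : nat) : nat := (trunc_log 2 m.*2).+1.*2.

Lemma flips_needed_le m : 1 <= logn2 R m ->
  (flips_needed m)%:R + 1 <= (2 / ln 2 + 3) * logn2 R m.
Proof.
move=> L1; have m0 : (0 < m.*2)%N.
  by rewrite -(ltr_nat R) -expR_logn2// expR_gt0.
have ln20 : 0 < ln 2 :> R by apply: ln_gt0; rewrite ltr1n.
have tl : (trunc_log 2 m.*2)%:R * ln 2 <= logn2 R m.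
  rewrite mulr_natl -lnXn//.
  rewrite /logn2 ler_ln ?posrE ?exprn_gt0 ?ltr0n// -natrX ler_nat.
  exact: trunc_logP.
rewrite -ler_pdivlMr// in tl.
rewrite /flips_needed -muln2 natrM -natr1.
have -> : (2 / ln 2 + 3) * logn2 R m = logn2 R m / ln 2 * 2 + 3 * logn2 R m.
  by field; rewrite gt_eqF.
lra.
Qed.

Lemma flips_needed_ge m : (m.*2 ^ 2 <= 2 ^ flips_needed m)%N.
Proof.
rewrite /flips_needed -[in leqRHS]muln2 expnM leq_exp2r//.
by rewrite ltnW// trunc_log_ltn.
Qed.

(** Common interface of the two regimes. The strict k < [#|I|] leaves one block to lose, as happens
    with arcs. *)
Definition good_blocks_flip (m : nat) : Prop :=
  forall (M : gbm_model R m.*2) (w : gbm_space M) (k : nat)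
         (I : {set 'I_(ncells R D m %/ W)}),
    in_circle M w -> (k < #|I|)%N ->
    (forall i, i \in I ->
       (forall u t, t \in S ->
          ~ cell (ncells R D m) (i * W + t) (loc M u w)) /\
       (exists u, cell (ncells R D m) (i * W + c) (loc M u w))) ->
    (#|[set gbm_graph (log_radius a m.*2) (log_radius b m.*2) A (locations w)
         | A : {set 'I_m.*2}]%SET| * 2 ^ k <= 2 ^ m.*2)%N.

Hypothesis flips : \forall m \near \oo, good_blocks_flip m.

(** The success probability is at most 4/mean (Chebyshev) plus 4 (1 - 1/N)^n (Markov) plus 2 (n +
    1)/2^k, and each term vanishes. *)
Lemma failure_of_flips (alg : forall m : nat, algorithm R m.*2)
    (M : forall m : nat, gbm_model R m.*2) :
  (forall m, uniform_part (M m)) ->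
  failure_prob (log_radius a m.*2) (log_radius b m.*2) (M m) (alg m)
    @[m --> \oo] --> 1%E.
Proof.
move=> unif.
pose f m := pr (gbm_prob (M m) \x seed_prob (alg m))%E
  (@success R m.*2 (log_radius a m.*2) (log_radius b m.*2) (M m) (alg m)).
rewrite (_ : (fun m => _) = fun m => (1 - f m)%:E); last first.
  apply/funext => m; rewrite failure_probE EFinB; congr (_ - _)%E.
  by apply: prE; exact: measurable_success.
apply: cvg_EFin_dist => eps eps0.
have W0 : (0 < W)%N by exact: leq_ltn_trans (ltn_ord c).
have W0' : (0 : R) < W%:R by rewrite ltr0n.
have D0 : (0 < D)%N by exact: leq_ltn_trans SD.
have D1 : 1 <= D%:R :> R by rewrite ler1n.
(* Makes [mean] at least kappa log^2 n, hence eventually above every multiple of log n. *)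
pose kappa : R := (2 * #|S|%:R + 1)^-1 ^+ 3 / (12 * W%:R).
have kappa0 : 0 < kappa.
  have t0 : 0 < 2 * #|S|%:R + 1 :> R.
    by apply: ltr_wpDl => //; exact: mulr_ge0.
  apply: divr_gt0; last exact: mulr_gt0.
  by rewrite exprn_gt0// invr_gt0.
have ln20 : 0 < ln 2 :> R by apply: ln_gt0; rewrite ltr1n.
near=> m.
have flipm : good_blocks_flip m by near: m; exact: flips.
have f0 : 0 <= f m by exact: pr_ge0.
rewrite opprB addrCA subrr addr0 ger0_norm//.
have L1 : 1 <= logn2 R m by near: m; exact: near_logn2.
have L0 : 0 < logn2 R m by apply: lt_le_trans L1.
have y0 := scale_gt0 L1; have /andP[N1 _] := ncells_bounds D L1.
set N := ncells R D m in N1.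
have N0 : (0 < N)%N.
  have y1 : 2 <= scale R m by near: m; exact: near_scale.
  have : scale R m <= D%:R * scale R m by rewrite ler_peMl// ltW.
  by rewrite -(ltr_nat R); lra.
have BW : (N %/ W * W <= N)%N by exact: leq_trunc_div.
pose mean : R := #|'I_(N %/ W)|%:R * (1 - #|S|%:R / N%:R) ^+ m.*2.
have mean_ge' : kappa * logn2 R m ^+ 2 <= mean.
  rewrite /mean card_ord /kappa mulrAC; apply: mean_ge => //.
    by near: m; exact: near_scale.
  by near: m; exact: near_scale.
have mean_geL C : C / kappa <= logn2 R m -> C * logn2 R m <= mean.
  move=> CL; apply: le_trans mean_ge'; rewrite expr2 mulrA ler_pM2r//.
  by rewrite mulrC -ler_pdivrMr.
have mean0 : 0 < mean.
  by apply: lt_le_trans mean_ge'; rewrite mulr_gt0// exprn_gt0.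
pose k := flips_needed m.
(* The successor yields the strict inequality asked by [good_blocks_flip]. *)
have kmean : 4 * k.+1%:R <= mean.
  apply: (@le_trans _ _ (4 * (2 / ln 2 + 3) * logn2 R m)).
    rewrite -mulrA ler_pM2l// -natr1; exact: flips_needed_le.
  by apply: mean_geL; near: m; exact: near_logn2.
pose bad := ~` in_circle (M m) `|` few_good_blocks (M := M m) S c BW.
have mC : measurable (~` in_circle (M m)).
  by apply: measurableC; exact: measurable_in_circle.
have mF := measurable_few_good_blocks (M m) S c BW.
have mbad : measurable bad by exact: measurableU.
have pbad : pr (gbm_prob (M m)) bad <=
    4 / mean + 4 * (1 - 1 / N%:R) ^+ m.*2.
  apply: le_trans (_ : pr (gbm_prob (M m)) (few_good_blocks (M := M m) S c BW) <= _).
    have := @union_bound _ _ _ (gbm_prob (M m)) bool bad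
      (fun e => if e then ~` in_circle (M m) else few_good_blocks (M := M m) S c BW).
    rewrite big_bool /= prC; last exact: measurable_in_circle.
    rewrite pr_in_circle subrr add0r; apply => //; first by case.
    by move=> w [] ?; [exists true|exists false].
  exact: pr_few_good_blocks.
have := @success_prob_le R m (log_radius a m.*2) (log_radius b m.*2) (M m)
  (alg m) (unif m) bad k mbad.
rewrite -/(f m) => /(_ _)/le_trans; apply.
  move=> w /not_orP[/contrapT inC nfew].
  have [I kI good] := good_blocks kmean nfew.
  exact: flipm good.
have part1 : 4 / mean <= eps / 3.
  rewrite ler_pdivrMr// [leRHS]mulrC -ler_pdivrMr; last by rewrite divr_gt0.
  apply: le_trans (mean_geL (4 / (eps / 3)) _); last by near: m; exact: near_logn2.
  by rewrite ler_peMr// divr_ge0// divr_ge0// ltW.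
have part2 : 4 * (1 - 1 / N%:R) ^+ m.*2 <= eps / 3.
  apply: (@le_trans _ _ (4 * (D%:R / logn2 R m))).
    by rewrite ler_pM2l//; exact: hole_bound.
  rewrite mulrA ler_pdivrMr// [leRHS]mulrC -ler_pdivrMr; last by rewrite divr_gt0.
  by near: m; exact: near_logn2.
have part3 : 2 * m.*2.+1%:R / 2 ^+ k <= eps / 3.
  have n0 : (0 : R) < m.*2%:R by rewrite -expR_logn2// expR_gt0.
  have n1 : 1 <= m.*2%:R :> R.
    by rewrite -expR_logn2// -expR0 ler_expR ltW.
  have nL : logn2 R m <= m.*2%:R.
    by rewrite -[leRHS]expR_logn2//; have := expR_ge1Dx (logn2 R m); lra.
  apply: (@le_trans _ _ (4 * m.*2%:R / m.*2%:R ^+ 2)).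
    apply: ler_pM => //.
    - by rewrite -natr1; lra.
    - rewrite lef_pV2 ?posrE ?exprn_gt0// -!natrX ler_nat.
      exact: flips_needed_ge.
  rewrite expr2 invfM mulrA mulfK ?gt_eqF//.
  rewrite ler_pdivrMr// [leRHS]mulrC -ler_pdivrMr; last by rewrite divr_gt0.
  by apply: le_trans nL; near: m; exact: near_logn2.
lra.
Unshelve. all: by end_near. Qed.

End Failure.

Lemma exists_nat_gt_scaled (R : realType) (e C : R) : 0 < e ->
  exists D : nat, C < e * D%:R.
Proof.
move=> e0; exists (Num.trunc (C / e)).+1.
by rewrite mulrC -ltr_pdivrMr//; exact: truncnS_gt.
Qed.

Section Impossibility.
Variables (R : realType) (a b : R).
Hypotheses (hb : 0 <= b) (hab : b < a).
Variables (alg : forall m : nat, algorithm R m.*2).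
Variables (M : forall m : nat, gbm_model R m.*2).
Hypothesis M_uniform : forall m : nat, uniform_part (M m).

Lemma ncells_radius_le D m (c : R) : 0 <= c -> 1 <= logn2 R m ->
  (ncells R D m)%:R * log_radius c m.*2 <= c * D%:R.
Proof.
move=> c0 L1; have y0 := scale_gt0 L1; have /andP[_ N2] := ncells_bounds D L1.
rewrite log_radiusE// mulrA ler_pdivrMr// -mulrA mulrC.
by rewrite ler_wpM2l.
Qed.

(** A gap of s >= a D cells is at least r_s long, while s < D keeps such gaps frequent; a < 1 leaves
    room for s. *)
Lemma failure_disconnected : a < 1 ->
  failure_prob (log_radius a m.*2) (log_radius b m.*2) (M m) (alg m)
    @[m --> \oo] --> 1%E.
Proof.
move=> a1; have a0 : 0 < a by exact: le_lt_trans hab.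
have a10 : 0 < 1 - a by rewrite subr_gt0.
have [D D1] := exists_nat_gt_scaled 1 a10.
pose s := (Num.trunc (a * D%:R)).+1.
have aD : 0 <= a * D%:R by rewrite mulr_ge0// ltW.
have s1 : a * D%:R <= s%:R by exact/ltW/truncnS_gt.
have sD : (s < D)%N.
  have := truncn_le (a * D%:R); rewrite aD => h.
  by rewrite -(ltr_nat R) /s -natr1; lra.
pose S := [set~ ord_max : 'I_s.+1]%SET.
have SD : (#|S| < D)%N by rewrite cardsC1 card_ord.
have cS : ord_max \notin S by rewrite !inE eqxx.
apply: (failure_of_flips SD cS _ alg M_uniform).
near=> m => M' w k I inC kI good.
have L1 : 1 <= logn2 R m by near: m; exact: near_logn2.
have y0 := scale_gt0 L1.
have B0 : (0 < ncells R D m %/ s.+1)%N.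
  have [i _] : exists i, i \in I by apply/card_gt0P; exact: leq_ltn_trans kI.
  exact: leq_ltn_trans (ltn_ord i).
apply: (@free_arcs _ _ (ncells R D m) _ _ _ _ _ w _ _ inC s I) => //.
- by apply: leq_trans (leq_trunc_div _ s.+1); rewrite muln_gt0 B0.
- by rewrite !log_radiusE// ler_pM2r ?invr_gt0// ltW.
- exact: leq_trunc_div.
- by apply: le_trans (ncells_radius_le D (ltW a0) L1) _.
- move=> i iI; have [empty occ] := good i iI; split=> // u t ts.
  have ts1 : (t < s.+1)%N by exact: ltnW.
  apply: (empty u (Ordinal ts1)).
  by rewrite !inE -val_eqE /= neq_ltn ts.
Unshelve. all: by end_near. Qed.

Lemma annulus_constants : a - b < 1 / 2 -> 0 < b ->
  exists D lo hi : nat, [/\ (0 < lo)%N, (lo <= hi)%N, ((hi - lo).+1.*2 < D)%N &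
    lo%:R + 1 <= b * D%:R /\ a * D%:R <= hi%:R].
Proof.
move=> hab2 b0; have e0 : 0 < 1 - 2 * (a - b) by lra.
(* With hi <= a D + 1 and lo > b D - 2, the annuli have 2 (hi - lo + 1) < 2 (a - b) D + 8 cells. The
   bound b D > 3 makes [lo] positive, which keeps the middle cell out of the annuli. *)
have [D1 hD1] := exists_nat_gt_scaled 8 e0.
have [D2 hD2] := exists_nat_gt_scaled 3 b0.
pose D := (D1 + D2)%N.
have hD1' : 8 < (1 - 2 * (a - b)) * D%:R.
  by apply: lt_le_trans hD1 _; rewrite ler_pM2l// ler_nat leq_addr.
have hD2' : 3 < b * D%:R.
  by apply: lt_le_trans hD2 _; rewrite ler_pM2l// ler_nat leq_addl.
have [lo [lo1 lo2]] : exists lo : nat, lo%:R + 1 <= b * D%:R /\ b * D%:R < lo%:R + 2.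
  have bD1 : 0 <= b * D%:R - 1 by lra.
  exists (Num.trunc (b * D%:R - 1)); have /andP[] := truncn_itv bD1.
  by rewrite -natr1 => ? ?; split; lra.
have [hi [hi1 hi2]] : exists hi : nat, a * D%:R <= hi%:R /\ hi%:R <= a * D%:R + 1.
  have aD0 : 0 <= a * D%:R by apply: mulr_ge0 => //; exact: ltW (lt_trans b0 hab).
  exists (Num.trunc (a * D%:R)).+1; have /andP[] := truncn_itv aD0.
  by rewrite -natr1 => ? ?; split; lra.
have abD : b * D%:R <= a * D%:R by rewrite ler_wpM2r// ltW.
have lohi : (lo <= hi)%N by rewrite -(ler_nat R); lra.
exists D, lo, hi; split => //.
  by rewrite -(ltr_nat R); lra.
by rewrite -(ltr_nat R) -muln2 natrM -natr1 natrB//; lra.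
Qed.

Lemma failure_uninformed : a - b < 1 / 2 -> 0 < b ->
  failure_prob (log_radius a m.*2) (log_radius b m.*2) (M m) (alg m)
    @[m --> \oo] --> 1%E.
Proof.
move=> hab2 b0; have a0 : 0 < a by exact: lt_trans hab.
have [D [lo [hi [lo0 lohi sD [bD aD]]]]] := annulus_constants hab2 b0.
have hiW : (hi < hi.*2.+1)%N by rewrite ltnS -addnn leq_addr.
pose c : 'I_hi.*2.+1 := Ordinal hiW.
pose S := [set t : 'I_hi.*2.+1 | (t + lo <= hi) || (hi + lo <= t <= hi.*2)]%N%SET.
have cS : c \notin S.
  by rewrite inE /= (_ : (hi + lo <= hi)%N = false) // -[leqRHS]addn0 leq_add2l leqNgt lo0.
have SD : (#|S| < D)%N.
  apply: leq_ltn_trans sD.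
  (* Enumerates both annuli, the Boolean choosing the side, to bound the cardinal of [S]. *)
  pose f (x : bool * 'I_(hi - lo).+1) : 'I_hi.*2.+1 :=
    inord (if x.1 then x.2 : nat else hi + lo + x.2)%N.
  have SI : S \subset [set f x | x in [set: bool * 'I_(hi - lo).+1]%SET]%SET.
    apply/fintype.subsetP => t; rewrite inE => /orP[tlo|/andP[thi thi2]].
      have tl : (t < (hi - lo).+1)%N by rewrite ltnS leq_subRL// addnC.
      apply/imsetP; exists (true, Ordinal tl); rewrite ?inE//.
      by rewrite /f /= inord_val.
    have tl : (t - (hi + lo) < (hi - lo).+1)%N.
      by clear -thi thi2 lohi; lia.
    apply/imsetP; exists (false, Ordinal tl); rewrite ?inE//.
    by rewrite /f /= subnKC// inord_val.
  apply: leq_trans (subset_leq_card SI) _; apply: leq_trans (leq_imset_card _ _) _.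
  by rewrite cardsT card_prod card_bool card_ord mul2n.
apply: (failure_of_flips SD cS _ alg M_uniform).
near=> m => M' w k I inC kI good.
have L1 : 1 <= logn2 R m by near: m; exact: near_logn2.
have y0 := scale_gt0 L1; have /andP[N1 _] := ncells_bounds D L1.
have B0 : (0 < ncells R D m %/ hi.*2.+1)%N.
  have [i _] : exists i, i \in I by apply/card_gt0P; exact: leq_ltn_trans kI.
  exact: leq_ltn_trans (ltn_ord i).
apply: (@free_annuli _ _ (ncells R D m) _ _ _ _ _ w _ _ inC lo hi I) => //.
- by apply: leq_trans (leq_trunc_div _ hi.*2.+1); rewrite muln_gt0 B0.
- by rewrite !log_radiusE// ler_pM2r ?invr_gt0// ltW.
- exact: leq_trunc_div.
(* Rounding [N] down loses at most b, covered by the spare cell in lo + 1 <= b D once b <=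
   [scale]. *)
- rewrite log_radiusE// mulrA ler_pdivlMr//.
  have : (D%:R * scale R m - 1) * b <= (ncells R D m)%:R * b.
    by rewrite ler_pM2r// ltW.
  have : (lo%:R + 1) * scale R m <= b * D%:R * scale R m by rewrite ler_pM2r.
  have : b <= scale R m by near: m; exact: near_scale.
  lra.
- by apply: le_trans (ncells_radius_le D (ltW a0) L1) _.
- exact: ltnW.
- move=> i iI; have [empty occ] := good i iI; split=> // u t ts.
  have tW : (t < hi.*2.+1)%N.
    by clear -ts lohi; move/orP: ts => [?|/andP[_ ?]]; lia.
  by apply: (empty u (Ordinal tW)); rewrite inE.
Unshelve. all: by end_near. Qed.

End Impossibility.

Theorem theorem11 (R : realType) (a b : R) (hb : 0 <= b) (hab : b < a) :
  (a - b < 1 / 2 \/ a < 1 ->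
    forall (alg : forall m : nat, algorithm R m.*2)
           (M : forall m : nat, gbm_model R m.*2),
      (forall m : nat, uniform_part (M m)) ->
      failure_prob (log_radius a m.*2) (log_radius b m.*2) (M m) (alg m)
        @[m --> \oo] --> 1%E)
  /\
  (1 / 2 < a - b /\ 1 < a ->
    exists alg : forall m : nat, algorithm R m.*2,
    forall M : forall m : nat, gbm_model R m.*2,
      success_prob (log_radius a m.*2) (log_radius b m.*2) (M m) (alg m)
        @[m --> \oo] --> 1%E).
Proof.
split=> [small alg M unif|[hab2 a1]]; last exact: exact_recovery.
(* When a >= 1, the condition a - b < 1/2 forces b > 0, as the annuli argument requires. *)
have [a1|a1] := ltP a 1; first exact: failure_disconnected.
by case: small => [hab2|]; [apply: failure_uninformed => //; lra|lra].
Qed.
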